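(* For $i=1,2$, let $\psi_i:\mathbb{R}^{n_i}\to\mathbb{R}$ be a smooth function whose Hessian is positive definite at each point of $\mathbb{R}^{n_i}$. Suppose that $\Phi_i:\mathbb{T}^{n_i}\times N_i\to N_i$ is a torification of $(\mathbb{R}^{n_i},\mathrm{Hess}(\psi_i),\nabla^{\mathrm{flat}})$, $i=1,2$. Let $\Phi=\Phi_1\times\Phi_2:\mathbb{T}^{n_1+n_2}\times(N_1\times N_2)\to N_1\times N_2$ be the torus action defined by $\Phi((a,b),(x,y))=(\Phi_1(a,x),\Phi_2(b,y))$. (1) $N_1\times N_2$, together with the torus action $\Phi$, is a torification of $(\mathbb{R}^{n_1+n_2},\mathrm{Hess}(\psi),\nabla^{\mathrm{flat}})$, where $\psi:\mathbb{R}^{n_1+n_2}=\mathbb{R}^{n_1}\times\mathbb{R}^{n_2}\to\mathbb{R}$, $\psi(x,y)=\psi_1(x)+\psi_2(y)$. (2) If $\tau_i:T\mathbb{R}^{n_i}\to N_i^\circ$ is a compatible covering map, $i=1,2$, then the map $\tau:T\mathbb{R}^{n_1+n_2}=T\mathbb{R}^{n_1}\times T\mathbb{R}^{n_2}\to N_1^\circ\times N_2^\circ$ defined by $\tau(u,v)=(\tau_1(u),\tau_2(v))$ is a compatible covering map. (3) If $N_1$ and $N_2$ are regular, then $N_1\times N_2$ is regular.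
   Context: Dually flat spaces. A linear connection is flat if its torsion and curvature both vanish. If $(M,h)$ is a Riemannian manifold with a linear connection $\nabla$, the dual connection $\nabla^*$ is the unique linear connection with $Xh(Y,Z)=h(\nabla_XY,Z)+h(Y,\nabla^*_XZ)$ for all vector fields $X,Y,Z$. The triple $(M,h,\nabla)$ is a dually flat space if $\nabla$ and $\nabla^*$ are both flat. $\nabla^{\mathrm{flat}}$ is the canonical flat connection on $\mathbb{R}^n$. If the Hessian matrix $\mathrm{Hess}(\psi)$ of $\psi:\mathbb{R}^n\to\mathbb{R}$ is everywhere positive definite, it is regarded as a Riemannian metric on $\mathbb{R}^n$, and $(\mathbb{R}^n,\mathrm{Hess}(\psi),\nabla^{\mathrm{flat}})$ is a dually flat space. Kähler structure on $TM$ (Dombrowski). Let $(M,h,\nabla)$ be dually flat, $\pi:TM\to M$ the projection, and $K:TTM\to TM$ the connector of $\nabla$ (the map, linear on each $T_u(TM)$, with $K(Y_*X)=\nabla_XY$ for all vector fields). For $u\in T_pM$ the map $A\mapsto(\pi_*A,KA)$ identifies $T_u(TM)$ with $T_pM\oplus T_pM$; under it set $g_u((v,w),(v',w'))=h_p(v,v')+h_p(w,w')$, $J_u(v,w)=(-w,v)$, $\omega_u((v,w),(v',w'))=h_p(v,w')-h_p(w,v')$. This makes $TM$ a Kähler manifold, and $TM$ always carries this structure. Parallel lattices. Let $(M,h,\nabla)$ be connected, $\dim M=n$. A parallel lattice is a subset $L\subset TM$ of the form $L=\{\sum_i k_iX_i(p)\mid p\in M,\ k_i\in\mathbb{Z}\}$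 where $X=(X_1,\dots,X_n)$ are $\nabla$-parallel vector fields forming a basis of $T_pM$ at every $p$; $X$ is called a generator of $L$. $\Gamma(L)$ is the group of maps $TM\to TM$, $u\mapsto u+\sum_ik_iX_i$ ($k\in\mathbb{Z}^n$); it does not depend on the generator, acts freely and properly by holomorphic isometries, and $M_L=TM/\Gamma(L)$ carries the quotient Kähler structure, with quotient map $q_L:TM\to M_L$. Put $\mathbb{T}^n=\mathbb{R}^n/\mathbb{Z}^n$; for a generator $X$ let $\Phi_X([t],q_L(u))=q_L(u+\sum_it_iX_i)$, an action of $\mathbb{T}^n$ on $M_L$. Torifications. Let $N$ be a connected Kähler manifold of real dimension $2n$ with an effective holomorphic isometric action $\Phi:\mathbb{T}^n\times N\to N$; write $\Phi_a=\Phi(a,\cdot)$ and let $N^\circ$ be the set of points where $\Phi$ is free. $N$ (or $\Phi$) is a torification of the connected $n$-dimensional dually flat space $(M,h,\nabla)$ if there is a toric parametrization, i.e. a triple $(L,X,F)$ where $L$ is a parallel lattice generated by $X$ and $F:M_L\to N^\circ$ is a holomorphic isometric diffeomorphism with $F\circ(\Phi_X)_a=\Phi_a\circ F$ for all $a\in\mathbb{T}^n$. A compatible covering map is a map $\tau:TM\to N^\circ$ of the form $\tau=F\circ q_L$ for some toric parametrization $(L,X,F)$. A Kähler manifold is regular if it is connected, simply connected, complete and its Kähler metric is real analytic. *)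

(* Defs.v *)
From HB Require Import structures.
From mathcomp Require Import all_boot all_order all_algebra.
From mathcomp Require Import generic_quotient.
From mathcomp Require Import all_classical all_reals all_analysis.
Import Order.TTheory GRing.Theory Num.Theory.
Import numFieldNormedType.Exports.

Set Implicit Arguments.
Unset Strict Implicit.
Unset Printing Implicit Defensive.

Local Open Scope classical_set_scope.
Local Open Scope ring_scope.
Local Open Scope quotient_scope.

(** ** Smooth and real analytic functions *)

(* [U] is meant to be open. *)
Fixpoint Ck {R : realType} {V W : normedModType R} (k : nat)
    (U : set V) (f : V -> W) : Prop :=
  match k with
  | 0 => forall x, U x -> {for x, continuous f}
  | k'.+1 => (forall x, U x -> differentiable f x) /\
             forall v, Ck k' U (fun x => 'd f x v)
  end.

Definition smooth {R : realType} {V W : normedModType R}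
    (U : set V) (f : V -> W) : Prop := forall k, Ck k U f.

(* The homogeneous part of degree [k] at [y] of the power series with
   coefficients [a]; a multi-index of length [k] has entries at most [k]. *)
Definition homog_part {R : realType} {m : nat} (a : ('I_m -> nat) -> R)
    (y : 'rV[R]_m) (k : nat) : R :=
  \sum_(al : {ffun 'I_m -> 'I_k.+1} | (\sum_i (al i : nat) == k)%N)
     a (fun i => al i) * \prod_i (y 0 i) ^+ al i.

(* The first condition is the absolute convergence of the multivariate power
   series. *)
Definition analytic {R : realType} {m : nat} (U : set 'rV[R]_m)
    (f : 'rV[R]_m -> R) : Prop :=
  forall x0, U x0 -> exists a : ('I_m -> nat) -> R,
    \forall x \near x0,
      cvgn (series (homog_part (fun al => `|a al|)
                               (\row_i `|(x - x0) 0 i|))) /\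
      series (homog_part a (x - x0)) @ \oo --> f x.

(** ** Dually flat structures on R^n *)

Definition vfield (R : realType) (n : nat) : Type := 'rV[R]_n -> 'rV[R]_n.

Definition mform {R : realType} {n : nat} (A : 'M[R]_n) (v w : 'rV[R]_n) : R :=
  (v *m A *m w^T) 0 0.

Definition posdef {R : realType} {n : nat} (A : 'M[R]_n) : Prop :=
  A^T = A /\ forall v : 'rV[R]_n, v != 0 -> 0 < mform A v v.

Definition hess {R : realType} {n : nat} (psi : 'rV[R]_n -> R)
    (p : 'rV[R]_n) : 'M[R]_n :=
  \matrix_(i, j) 'D_(delta_mx 0 i) ('D_(delta_mx 0 j) psi) p.

Definition is_riemannian {R : realType} {n : nat} (h : 'rV[R]_n -> 'M[R]_n) :
    Prop :=
  smooth setT h /\ forall p, posdef (h p).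

Definition is_connection {R : realType} {n : nat}
    (nabla : vfield R n -> vfield R n -> vfield R n) : Prop :=
  [/\ forall X Y, smooth setT X -> smooth setT Y -> smooth setT (nabla X Y),
      forall X X' Y p, smooth setT X -> smooth setT X' -> smooth setT Y ->
        nabla (fun q => X q + X' q) Y p = nabla X Y p + nabla X' Y p,
      forall (f : 'rV[R]_n -> R) X Y p,
        smooth setT f -> smooth setT X -> smooth setT Y ->
        nabla (fun q => f q *: X q) Y p = f p *: nabla X Y p,
      forall X Y Y' p, smooth setT X -> smooth setT Y -> smooth setT Y' ->
        nabla X (fun q => Y q + Y' q) p = nabla X Y p + nabla X Y' p &
      forall (f : 'rV[R]_n -> R) X Y p,
        smooth setT f -> smooth setT X -> smooth setT Y ->
        nabla X (fun q => f q *: Y q) p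
          = 'd f p (X p) *: Y p + f p *: nabla X Y p].

Definition lie_bracket {R : realType} {n : nat} (X Y : vfield R n) :
    vfield R n :=
  fun p => 'd Y p (X p) - 'd X p (Y p).

Definition is_flat {R : realType} {n : nat}
    (nabla : vfield R n -> vfield R n -> vfield R n) : Prop :=
  (forall X Y p, smooth setT X -> smooth setT Y ->
     nabla X Y p - nabla Y X p - lie_bracket X Y p = 0) /\
  (forall X Y Z p, smooth setT X -> smooth setT Y -> smooth setT Z ->
     nabla X (nabla Y Z) p - nabla Y (nabla X Z) p
       - nabla (lie_bracket X Y) Z p = 0).

Definition is_dual {R : realType} {n : nat} (h : 'rV[R]_n -> 'M[R]_n)
    (nabla nabla' : vfield R n -> vfield R n -> vfield R n) : Prop :=
  forall X Y Z p, smooth setT X -> smooth setT Y -> smooth setT Z ->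
    'd (fun q => mform (h q) (Y q) (Z q)) p (X p)
      = mform (h p) (nabla X Y p) (Z p) + mform (h p) (Y p) (nabla' X Z p).

Definition dually_flat {R : realType} {n : nat} (h : 'rV[R]_n -> 'M[R]_n)
    (nabla : vfield R n -> vfield R n -> vfield R n) : Prop :=
  [/\ is_riemannian h, is_connection nabla, is_flat nabla &
      exists nabla', [/\ is_connection nabla', is_dual h nabla nabla' &
                         is_flat nabla']].

Definition nabla_flat {R : realType} {n : nat} (X Y : vfield R n) :
    vfield R n :=
  fun p => 'd Y p (X p).

(** ** The tangent bundle of R^n, and the model space C^n *)

(* [TR R n] is both the total space of the tangent bundle of R^n, a point of
   which is a pair (base point, vector), and the model space of n-dimensional
   complex manifolds, (x, y) standing for x + iy. *)
Notation TR R n := ('rV[R]_n * 'rV[R]_n)%type (only parsing).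

Definition cplxJ {R : realType} {n : nat} (z : TR R n) : TR R n :=
  (- z.2, z.1).

(* [K u] acts on T_u(TR^n), identified with R^n * R^n. *)
Definition is_connector {R : realType} {n : nat}
    (nabla : vfield R n -> vfield R n -> vfield R n)
    (K : TR R n -> TR R n -> 'rV[R]_n) : Prop :=
  (forall u c A B, K u (c *: A + B) = c *: K u A + K u B) /\
  (forall X Y p, smooth setT X -> smooth setT Y ->
     K (p, Y p) ('d (fun q => (q, Y q)) p (X p)) = nabla X Y p).

Definition connector_flat {R : realType} {n : nat} (u A : TR R n) :
  'rV[R]_n := A.2.

Lemma connector_flatP {R : realType} {n : nat} :
  is_connector (@nabla_flat R n) connector_flat.
Proof.
split => [//|X Y p _ sY].
have [dY _] := sY 1.
have dYp := dY p I.
by rewrite (@diff_pair _ _ _ _ id Y).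
Qed.

Lemma cplxJ_dombrowski {R : realType} {n : nat} (u A : TR R n) :
  (cplxJ A).1 = - connector_flat u A /\ connector_flat u (cplxJ A) = A.1.
Proof. by []. Qed.

Definition dombrowski_metric {R : realType} {n : nat}
    (h : 'rV[R]_n -> 'M[R]_n) (u A B : TR R n) : R :=
  mform (h u.1) A.1 B.1
  + mform (h u.1) (connector_flat u A) (connector_flat u B).

(** ** Manifolds *)

Record atlas (R : realType) (V : normedModType R) (T : topologicalType) :=
  Atlas {
    chart_index : Type;
    chart_dom : chart_index -> set T;
    chart : chart_index -> T -> V;
    chart_inv : chart_index -> V -> T }.

Definition chart_img {R : realType} {V : normedModType R} {T : topologicalType}
    (A : atlas V T) (i : chart_index A) : set V :=
  chart i @` chart_dom i.

Definition coord_dom {R : realType} {V V' : normedModType R}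
    {T T' : topologicalType} (A : atlas V T) (A' : atlas V' T') (U : set T)
    (f : T -> T') (i : chart_index A) (j : chart_index A') : set V :=
  [set x | [/\ chart_img i x, U (chart_inv i x)
             & chart_dom j (f (chart_inv i x))]].

Definition coord_map {R : realType} {V V' : normedModType R}
    {T T' : topologicalType} (A : atlas V T) (A' : atlas V' T')
    (f : T -> T') (i : chart_index A) (j : chart_index A') : V -> V' :=
  fun x => chart j (f (chart_inv i x)).

Definition smooth_on {R : realType} {V V' : normedModType R}
    {T T' : topologicalType} (A : atlas V T) (A' : atlas V' T') (U : set T)
    (f : T -> T') : Prop :=
  (forall P, U P -> {for P, continuous f}) /\
  (forall i j, smooth (coord_dom U f i j) (coord_map (A := A) (A' := A') f i j)).

Definition is_manifold {R : realType} {V : normedModType R}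
    {T : topologicalType} (A : atlas V T) : Prop :=
  [/\ hausdorff_space T, @second_countable T,
      (forall P, exists i, chart_dom (a := A) i P),
      (forall i : chart_index A,
        [/\ open (chart_dom i), open (chart_img i),
            forall P, chart_dom i P ->
              {for P, continuous (chart i)} /\ chart_inv i (chart i P) = P &
            forall x, chart_img i x ->
              {for x, continuous (chart_inv i)} /\ chart_dom i (chart_inv i x)])
    & smooth_on A A setT id].

Definition atlas_prod {R : realType} {V V' : normedModType R}
    {T T' : topologicalType} (A : atlas V T) (A' : atlas V' T') :
    atlas (V * V')%type (T * T')%type :=
  @Atlas R (V * V')%type (T * T')%type
    (chart_index A * chart_index A')%type
    (fun i => chart_dom i.1 `*` chart_dom i.2)
    (fun i P => (chart i.1 P.1, chart i.2 P.2))
    (fun i x => (chart_inv i.1 x.1, chart_inv i.2 x.2)).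

(* Charts of a quotient [Q] of the vector space [V]: the local inverses of the
   projection, i.e. pairs made of an open set [D] and a map [s] with
   [s (\pi x) = x] on [D]. *)
Record local_section (R : realType) (V : normedModType R) (Q : quotType V) :=
  LocalSection {
    section_dom : set V;
    section_map : Q -> V;
    _ : open section_dom;
    _ : forall x, section_dom x -> section_map (\pi_Q x) = x }.

Definition quotient_atlas {R : realType} {V : normedModType R}
    (Q : quotType V) : atlas V (quotient_topology Q) :=
  @Atlas R V (quotient_topology Q) (local_section Q)
    (fun s => \pi_Q @` section_dom s)
    (fun s => section_map s)
    (fun s => \pi_Q).

(** ** Kaehler manifolds *)

(* [kmetric i P a b] is the value at [P] of the metric on the two tangent
   vectors with coordinates [a] and [b] in the chart [i]. *)
Record kahler_data (R : realType) (n : nat) := KahlerData {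
  kspace :> topologicalType;
  katlas : atlas (TR R n) kspace;
  kmetric : chart_index katlas -> kspace -> TR R n -> TR R n -> R }.

Definition holomorphic {R : realType} {n m : nat}
    (N : kahler_data R n) (N' : kahler_data R m) (f : N -> N') : Prop :=
  smooth_on (katlas N) (katlas N') setT f /\
  forall i j x a, coord_dom setT f i j x ->
    'd (coord_map (A := katlas N) (A' := katlas N') f i j) x (cplxJ a)
      = cplxJ ('d (coord_map f i j) x a).

Definition isometric {R : realType} {n m : nat}
    (N : kahler_data R n) (N' : kahler_data R m) (f : N -> N') : Prop :=
  forall i j x a b, coord_dom setT f i j x ->
    kmetric (k := N') j (f (chart_inv i x))
      ('d (coord_map f i j) x a) ('d (coord_map f i j) x b)
    = kmetric (k := N) i (chart_inv i x) a b.

Definition kform {R : realType} {n : nat} (N : kahler_data R n)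
    (i : chart_index (katlas N)) (P : N) (a b : TR R n) : R :=
  kmetric i P (cplxJ a) b.

(* The identity being holomorphic and isometric in charts says that the
   transition maps are holomorphic and that the local expressions of the metric
   agree on overlaps. The last clause is the closedness of the Kaehler form. *)
Definition is_kahler {R : realType} {n : nat} (N : kahler_data R n) : Prop :=
  [/\ is_manifold (katlas N), holomorphic (N := N) (N' := N) id,
      isometric (N := N) (N' := N) id,
      (forall (i : chart_index (katlas N)) (P : N), chart_dom i P ->
        [/\ forall c a a' b, kmetric i P (c *: a + a') b
                             = c * kmetric i P a b + kmetric i P a' b,
            forall a b, kmetric i P a b = kmetric i P b a,
            forall a, a != 0 -> 0 < kmetric i P a a &
            forall a b, kmetric i P (cplxJ a) (cplxJ b) = kmetric i P a b]) &
      (forall i : chart_index (katlas N),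
        (forall a b, smooth (chart_img i)
                       (fun x => kmetric i (chart_inv i x) a b)) /\
        (forall x a b c, chart_img i x ->
          'd (fun y => kform i (chart_inv i y) b c) x a
          + 'd (fun y => kform i (chart_inv i y) c a) x b
          + 'd (fun y => kform i (chart_inv i y) a b) x c = 0))].

Definition diffeo_onto {R : realType} {n : nat} (N N' : kahler_data R n)
    (F : N -> N') (U : set N') : Prop :=
  [/\ open U, (forall P, U (F P)), smooth_on (katlas N) (katlas N') setT F &
      exists G : N' -> N,
        [/\ cancel F G, forall Q, U Q -> F (G Q) = Q &
            smooth_on (katlas N') (katlas N) U G]].

(** *** Regularity *)

Definition simply_connected (R : realType) (T : topologicalType) : Prop :=
  (forall x y : T, exists c : R -> T,
     [/\ {within `[0, 1], continuous c}, c 0 = x & c 1 = y]) /\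
  (forall c : R -> T, {within `[0, 1], continuous c} -> c 0 = c 1 ->
     exists H : R * R -> T,
       [/\ {within `[0, 1] `*` `[0, 1], continuous H},
           forall s, s \in `[0, 1] -> H (s, 0) = c s,
           forall s, s \in `[0, 1] -> H (s, 1) = c 0 &
           forall t, t \in `[0, 1] -> H (0, t) = c 0 /\ H (1, t) = c 0]).

(* The geodesic equation in a chart, paired with an arbitrary vector [w]:
   g(c'' , w) + Gamma(c', c', w) = 0, where, by the formula for the Christoffel
   symbols of the first kind, Gamma(v, v, w) = (D_v g)(v, w) - (D_w g)(v, v) / 2. *)
Definition geodesic {R : realType} {n : nat} (N : kahler_data R n)
    (c : R -> N) : Prop :=
  continuous c /\
  forall (t : R) (i : chart_index (katlas N)), chart_dom i (c t) ->
    let x := chart i \o c in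
    let v := derive1 x t in
    let g a b := fun y => kmetric i (chart_inv i y) a b in
    [/\ \forall s \near t, derivable x s 1,
        derivable (derive1 x) t 1 &
        forall w, g (derive1 (derive1 x) t) w (x t) + 'd (g v w) (x t) v
                  - 2^-1 * 'd (g v v) (x t) w = 0].

Definition complete_kahler {R : realType} {n : nat} (N : kahler_data R n) :
    Prop :=
  forall (P : N) (i : chart_index (katlas N)) (v : TR R n), chart_dom i P ->
    exists c : R -> N, [/\ geodesic c, c 0 = P & derive1 (chart i \o c) 0 = v].

Definition analytic_metric {R : realType} {n : nat} (N : kahler_data R n) :
    Prop :=
  forall (i : chart_index (katlas N)) (a b : TR R n),
    analytic [set x : 'rV[R]_(n + n) | chart_img i (lsubmx x, rsubmx x)]
      (fun x => kmetric i (chart_inv i (lsubmx x, rsubmx x)) a b).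

Definition regular {R : realType} {n : nat} (N : kahler_data R n) : Prop :=
  [/\ connected [set: N], simply_connected R N, complete_kahler N &
      analytic_metric N].

(** *** Products *)

Definition TR_left {R : realType} {n1 n2 : nat} (u : TR R (n1 + n2)) :
  TR R n1 := (lsubmx u.1, lsubmx u.2).

Definition TR_right {R : realType} {n1 n2 : nat} (u : TR R (n1 + n2)) :
  TR R n2 := (rsubmx u.1, rsubmx u.2).

Definition TR_join {R : realType} {n1 n2 : nat} (u : TR R n1) (v : TR R n2) :
  TR R (n1 + n2) := (row_mx u.1 v.1, row_mx u.2 v.2).

Definition kahler_prod {R : realType} {n1 n2 : nat}
    (N1 : kahler_data R n1) (N2 : kahler_data R n2) :
    kahler_data R (n1 + n2) :=
  @KahlerData R (n1 + n2) (N1 * N2)%type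
    (@Atlas R (TR R (n1 + n2)) (N1 * N2)%type
      (chart_index (katlas N1) * chart_index (katlas N2))%type
      (fun i => chart_dom i.1 `*` chart_dom i.2)
      (fun i P => TR_join (chart i.1 P.1) (chart i.2 P.2))
      (fun i x => (chart_inv i.1 (TR_left x), chart_inv i.2 (TR_right x))))
    (fun i P a b => kmetric i.1 P.1 (TR_left a) (TR_left b)
                    + kmetric i.2 P.2 (TR_right a) (TR_right b)).

(** ** The torus R^n / Z^n and its actions *)

Definition int_rel {R : realType} {n : nat} (s t : 'rV[R]_n) : bool :=
  `[< exists k : 'I_n -> int, t = s + \row_i (k i)%:~R >].

Lemma int_rel_equiv {R : realType} {n : nat} :
  equiv_class_of (@int_rel R n).
Proof.
split.
- move=> s; apply/asboolP; exists (fun=> 0).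
  by apply/rowP => i; rewrite !mxE addr0.
- have H s t : @int_rel R n s t -> int_rel t s.
    move=> /asboolP[k ->]; apply/asboolP; exists (fun i => - k i).
    by apply/rowP => i; rewrite !mxE mulrNz addrK.
  by move=> s t; apply/idP/idP; exact: H.
- move=> t s r /asboolP[k ->] /asboolP[l ->]; apply/asboolP.
  exists (fun i => k i + l i).
  by apply/rowP => i; rewrite !mxE mulrzDr addrA.
Qed.

Canonical int_equiv {R : realType} {n : nat} : equiv_rel 'rV[R]_n :=
  EquivRelPack (@int_rel_equiv R n).

Definition torus_quot (R : realType) (n : nat) : quotType 'rV[R]_n :=
  {eq_quot (@int_equiv R n)}.

Definition torus (R : realType) (n : nat) : topologicalType :=
  quotient_topology (torus_quot R n).

Definition torus_pi {R : realType} {n : nat} (t : 'rV[R]_n) : torus R n :=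
  \pi_(torus_quot R n) t.

Definition torus_repr {R : realType} {n : nat} (a : torus R n) : 'rV[R]_n :=
  repr (a : torus_quot R n).

Definition is_torus_action {R : realType} {n : nat} (N : kahler_data R n)
    (Phi : torus R n -> N -> N) : Prop :=
  [/\ forall x, Phi (torus_pi 0) x = x,
      forall s t x, Phi (torus_pi (s + t)) x
                    = Phi (torus_pi s) (Phi (torus_pi t) x) &
      smooth_on (atlas_prod (quotient_atlas (torus_quot R n)) (katlas N))
        (katlas N) setT (fun ax : torus R n * N => Phi ax.1 ax.2)].

Definition effective {R : realType} {n : nat} (N : kahler_data R n)
    (Phi : torus R n -> N -> N) : Prop :=
  forall a, (forall x, Phi a x = x) -> a = torus_pi 0.

Definition free_points {R : realType} {n : nat} (N : kahler_data R n)
    (Phi : torus R n -> N -> N) : set N :=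
  [set x | forall a, Phi a x = x -> a = torus_pi 0].

(* Phi1 x Phi2, through R^(n1+n2) / Z^(n1+n2) = R^n1 / Z^n1 x R^n2 / Z^n2. *)
Definition prod_action {R : realType} {n1 n2 : nat}
    (N1 : kahler_data R n1) (N2 : kahler_data R n2)
    (Phi1 : torus R n1 -> N1 -> N1) (Phi2 : torus R n2 -> N2 -> N2)
    (a : torus R (n1 + n2)) (P : kahler_prod N1 N2) : kahler_prod N1 N2 :=
  (Phi1 (torus_pi (lsubmx (torus_repr a))) P.1,
   Phi2 (torus_pi (rsubmx (torus_repr a))) P.2).

(** ** Parallel lattices and the quotients M_L *)

Definition is_parallel {R : realType} {n : nat}
    (nabla : vfield R n -> vfield R n -> vfield R n) (X : vfield R n) : Prop :=
  smooth setT X /\ forall Y p, smooth setT Y -> nabla Y X p = 0.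

Definition is_generator {R : realType} {n : nat}
    (nabla : vfield R n -> vfield R n -> vfield R n)
    (L : set (TR R n)) (X : 'I_n -> vfield R n) : Prop :=
  [/\ forall i, is_parallel nabla (X i),
      forall p, (\matrix_(i < n) X i p) \in unitmx &
      L = [set u | exists k : 'I_n -> int, u.2 = \sum_i (X i u.1) *~ k i]].

Definition lattice_shift {R : realType} {n : nat} (X : 'I_n -> vfield R n)
    (k : 'I_n -> int) (u : TR R n) : TR R n :=
  (u.1, u.2 + \sum_i (X i u.1) *~ k i).

Definition Gamma_rel {R : realType} {n : nat} (X : 'I_n -> vfield R n)
    (u v : TR R n) : bool :=
  `[< exists k, v = lattice_shift X k u >].

Lemma Gamma_rel_equiv {R : realType} {n : nat} (X : 'I_n -> vfield R n) :
  equiv_class_of (Gamma_rel X).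
Proof.
split.
- move=> [p v]; apply/asboolP; exists (fun=> 0).
  by rewrite /lattice_shift big1 /= ?addr0.
- have H s t : Gamma_rel X s t -> Gamma_rel X t s.
    move=> /asboolP[k ->]; apply/asboolP; exists (fun i => - k i).
    rewrite /lattice_shift /= -addrA -big_split big1 /= ?addr0 -?surjective_pairing//.
    by move=> i _; rewrite mulrNz subrr.
  by move=> s t; apply/idP/idP; exact: H.
- move=> t s r /asboolP[k ->] /asboolP[l ->]; apply/asboolP.
  exists (fun i => k i + l i).
  rewrite /lattice_shift /= -addrA -big_split /=; congr (_, _ + _).
  by apply: eq_bigr => i _; rewrite mulrzDr.
Qed.

Canonical Gamma_equiv {R : realType} {n : nat} (X : 'I_n -> vfield R n) :
  equiv_rel (TR R n) := EquivRelPack (Gamma_rel_equiv X).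

(* TM / Gamma(L), for L generated by X. *)
Definition ML_quot {R : realType} {n : nat} (X : 'I_n -> vfield R n) :
  quotType (TR R n) := {eq_quot (Gamma_equiv X)}.

(* The metric is the one for which the local inverses of the quotient map are
   isometries into (TM, g). *)
Definition ML {R : realType} {n : nat} (h : 'rV[R]_n -> 'M[R]_n)
    (X : 'I_n -> vfield R n) : kahler_data R n :=
  @KahlerData R n (quotient_topology (ML_quot X)) (quotient_atlas (ML_quot X))
    (fun s P => dombrowski_metric h (section_map s P)).

Definition qL {R : realType} {n : nat} (h : 'rV[R]_n -> 'M[R]_n)
    (X : 'I_n -> vfield R n) (u : TR R n) : ML h X :=
  \pi_(ML_quot X) u.

Definition PhiX {R : realType} {n : nat} (h : 'rV[R]_n -> 'M[R]_n)
    (X : 'I_n -> vfield R n) (a : torus R n) (P : ML h X) : ML h X :=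
  let u := repr (P : ML_quot X) in
  qL h X (u.1, u.2 + \sum_i torus_repr a 0 i *: X i u.1).

(** ** Torifications of (R^n, h, nabla_flat) *)

Definition toric_parametrization {R : realType} {n : nat}
    (h : 'rV[R]_n -> 'M[R]_n) (N : kahler_data R n)
    (Phi : torus R n -> N -> N)
    (L : set (TR R n)) (X : 'I_n -> vfield R n) (F : ML h X -> N) : Prop :=
  [/\ is_generator nabla_flat L X,
      diffeo_onto F (free_points Phi),
      holomorphic F,
      isometric F &
      forall a P, F (PhiX a P) = Phi a (F P)].

Definition compatible_covering {R : realType} {n : nat}
    (h : 'rV[R]_n -> 'M[R]_n) (N : kahler_data R n)
    (Phi : torus R n -> N -> N) (tau : TR R n -> N) : Prop :=
  exists L X (F : ML h X -> N),
    toric_parametrization Phi L F /\ forall u, tau u = F (qL h X u).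

Definition torification {R : realType} {n : nat}
    (h : 'rV[R]_n -> 'M[R]_n) (N : kahler_data R n)
    (Phi : torus R n -> N -> N) : Prop :=
  [/\ dually_flat h nabla_flat,
      is_kahler N /\ connected [set: N],
      is_torus_action Phi /\ effective Phi,
      forall a, holomorphic (Phi a) /\ isometric (Phi a) &
      exists L X (F : ML h X -> N), toric_parametrization Phi L F].

(* Main.v *)
Require Import Defs.
From HB Require Import structures.
From mathcomp Require Import all_boot all_order all_algebra.
From mathcomp Require Import generic_quotient ring lra zify.
From mathcomp Require Import all_classical all_reals all_analysis.
Import Order.TTheory GRing.Theory Num.Theory.
Import numFieldNormedType.Exports.
Set Implicit Arguments.
Unset Strict Implicit.
Unset Printing Implicit Defensive.
Local Open Scope classical_set_scope.
Local Open Scope ring_scope.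
Local Open Scope quotient_scope.

(** Everything splits along R^(n1+n2) = R^n1 x R^n2, but two points need an
    argument.

    First, Hess(psi) with the flat connection is dually flat for every potential
    psi with positive definite Hessian, in particular for
    psi(x, y) = psi1(x) + psi2(y). A metric h identifies vector fields with
    1-forms, and the transport of the flat connection by this identification is
    dual to it; its curvature vanishes since it is conjugate to a flat
    connection, and its torsion vanishes exactly when the derivative of h is
    totally symmetric. For a Hessian this is the symmetry of third derivatives
    ([codazzi_dually_flat], [hess_codazzi]), which comes from Schwarz's theorem
    ([diff_sym]).

    Second, the model space M_L of the product is the Kaehler product of the
    model spaces of the factors. A parallel frame of the flat connection is
    constant, so it is an invertible matrix ([generator_cst_frame]); the frames
    C1 and C2 of two toric parametrizations give the block diagonal frame of the
    product, whose lattice is the product of the lattices. The charts of a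
    quotient being all its local sections, a chart of M_L on an arbitrary open
    set is only locally a product of charts of the factors. The notion
    [kahler_split] of a pair of projections along which charts and metric split
    locally covers both M_L ([ML_split]) and the product N1 x N2
    ([kahler_prod_split]). A map between two split manifolds that acts on each
    component separately is, near each point of a chart, the join of the
    coordinate expressions of its components ([coord_map_split]); smoothness,
    holomorphy and the isometry property are then inherited from the components
    ([split_smooth_on], [split_holomorphic], [split_isometric]).

    This one principle gives that N1 x N2 is Kaehler (apply it to the identity),
    that the product action is smooth, holomorphic and isometric, and that
    F = F1 x F2, read on M_L, is a holomorphic isometric diffeomorphism onto the
    free points of the product, which are the pairs of free points
    ([prod_toric_parametrization]). As F (q_L u) has the components
    F1 (q_L1 u1) and F2 (q_L2 u2), compatible coverings multiply.

    Regularity is inherited because connectedness and null-homotopies, solutions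
    of the geodesic equation and power series expansions of the metric can all
    be taken componentwise ([regular_prod]). *)

(** * Differential calculus of smooth maps *)

Section near_diff.
Context {R : realType} {V W : normedModType R}.

Lemma near_eq_expansion (f g : V -> W) (x : V) (d : {linear V -> W}) :
  {near x, f =1 g} ->
  f \o shift x = cst (f x) + d +o_ 0 id ->
  g \o shift x = cst (g x) + d +o_ 0 id.
Proof.
move=> fg /eqaddoP Hf; apply/eqaddoP => e e0.
have fgx := nbhs_singleton fg.
have : \forall h \near (0 : V), f (h + x) = g (h + x).
  by move: fg; rewrite -[{near x, _}]/(\forall y \near x, f y = g y)
    (near_shift 0 x) subr0.
apply: filterS2 (Hf e e0) => h /=.
by rewrite !fctE /= => + fgh; rewrite fgh fgx.
Qed.

(** The differential is chosen among the linear maps of a first-order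
    expansion at the point, and the expansion depends only on the germ of the
    map. *)
Lemma near_eq_diff (f g : V -> W) (x : V) : {near x, f =1 g} ->
  differentiable f x -> differentiable g x /\ 'd g x = 'd f x :> (V -> W).
Proof.
move=> fg df; have [dc fd] := (diff_locallyP _ _).1 df.
have gd := near_eq_expansion fg fd.
have dE : 'd g x = 'd f x :> (V -> W) by exact: diff_unique.
split; last exact: dE.
by apply/diff_locallyP; rewrite dE; split.
Qed.

End near_diff.

Lemma diff_linear {R : realType} {V W : normedModType R} (L : V -> W) (x : V) :
  linear L -> continuous L -> differentiable L x /\ 'd L x = L :> (V -> W).
Proof.
move=> linL cL.
pose lm := GRing.isLinear.Build _ _ _ _ _ linL.
pose LL : {linear _ -> _} := HB.pack L lm.
split; first exact: (@linear_differentiable _ _ _ LL).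
exact: (@diff_lin _ _ _ LL).
Qed.

Section Ck_theory.
Context {R : realType} {V : normedModType R}.
Implicit Types (W : normedModType R) (U : set V).

(** This lemma and the next two are values at a vector of equations between
    differentials, for maps given pointwise. *)
Lemma diff_addE W (f g : V -> W) x v : differentiable f x ->
  differentiable g x ->
  'd (fun y => f y + g y) x v = 'd f x v + 'd g x v.
Proof. by move=> df dg; exact: (congr1 (fun h : V -> W => h v) (diffD df dg)). Qed.

Lemma diff_scaleE W (c : R) (f : V -> W) x v : differentiable f x ->
  'd (fun y => c *: f y) x v = c *: 'd f x v.
Proof. by move=> df; exact: (congr1 (fun h : V -> W => h v) (diffZ c df)). Qed.

Lemma diff_compE W W' (f : V -> W) (g : W -> W') x v : differentiable f x ->
  differentiable g (f x) ->
  'd (fun y => g (f y)) x v = 'd g (f x) ('d f x v).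
Proof.
by move=> df dg; exact: (congr1 (fun h : V -> W' => h v) (diff_comp df dg)).
Qed.

(** Derivatives enter the definition, so the maps must agree near each point
    of [U] and not only on [U]. *)
Lemma Ck_eq W k U (f g : V -> W) :
  open U -> (forall x, U x -> f x = g x) -> Ck k U f -> Ck k U g.
Proof.
move=> oU; have near_fg (f' g' : V -> W) :
    (forall x, U x -> f' x = g' x) -> forall x, U x -> {near x, f' =1 g'}.
  by move=> fg x Ux; apply: filterS fg _; exact: open_nbhs_nbhs.
elim: k f g => [|k IH] f g fg /=.
  move=> fc x Ux; rewrite /prop_for /continuous_at -(fg _ Ux).
  by apply: cvg_trans (fc _ Ux); apply: near_eq_cvg; exact: near_fg.
move=> [df Cf]; split.
  by move=> x Ux; have [] := near_eq_diff (near_fg _ _ fg x Ux) (df x Ux).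
move=> v; apply: IH (Cf v) => x Ux.
by have [_ ->] := near_eq_diff (near_fg _ _ fg x Ux) (df x Ux).
Qed.

Lemma Ck_sub W k U U' (f : V -> W) : U' `<=` U -> Ck k U f -> Ck k U' f.
Proof.
move=> sU; elim: k f => [|k IH] f /=; first by move=> fc x /sU; exact: fc.
by move=> [df Cf]; split=> [x /sU/df//|v]; exact: IH.
Qed.

(** Continuity and differentiability at a point of [U] concern a full
    neighbourhood of it, inside [U] or not. *)
Lemma Ck_local W k U (f : V -> W) :
  (forall x, U x -> exists2 U', U' x & Ck k U' f) -> Ck k U f.
Proof.
elim: k f => [|k IH] f /= loc.
  by move=> x /loc [U' U'x]; exact.
split=> [x /loc [U' U'x [+ _]]|v]; first exact.
by apply: IH => x /loc [U' U'x [_ Cf]]; exists U'.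
Qed.

Lemma Ck_diff W k U (f : V -> W) x : Ck k.+1 U f -> U x -> differentiable f x.
Proof. by move=> [+ _]; exact. Qed.

Lemma CkW W k U (f : V -> W) : Ck k.+1 U f -> Ck k U f.
Proof.
elim: k f => [|k IH] f [df Cf].
  by move=> x Ux; apply: differentiable_continuous; exact: df.
by split=> // v; apply: IH; exact: Cf.
Qed.

Lemma Ck_cst W k U (c : W) : Ck k U (fun=> c).
Proof.
elim: k c => [|k IH] c; first by move=> x _; exact: cvg_cst.
split=> [x _|v]; first exact: differentiable_cst.
rewrite (_ : (fun x => _) = fun=> 0); first exact: IH.
by apply/funext => x; rewrite (diff_cst c x).
Qed.

Lemma CkD W k U (f g : V -> W) : open U -> Ck k U f -> Ck k U g ->
  Ck k U (fun x => f x + g x).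
Proof.
move=> oU; elim: k f g => [|k IH] f g.
  by move=> fc gc x Ux; apply: cvgD; [exact: fc|exact: gc].
move=> [df Cf] [dg Cg]; split=> [x Ux|v].
  by apply: differentiableD; [exact: df|exact: dg].
apply: Ck_eq (IH _ _ (Cf v) (Cg v)) => // x Ux.
by apply/esym/diff_addE; [exact: df|exact: dg].
Qed.

Lemma diff_scalep W (f : V -> R) (g : V -> W) x :
  differentiable f x -> differentiable g x ->
  differentiable (fun y => f y *: g y) x /\
  forall v, 'd (fun y => f y *: g y) x v = 'd f x v *: g x + f x *: 'd g x v.
Proof.
move=> df dg.
have cS : continuous (fun p : R * W => p.1 *: p.2) by exact: scale_continuous.
have bS : bilinear_for (GRing.Scale.Law.clone _ _ *:%R _)
    (GRing.Scale.Law.clone _ _ *:%R _) ( *:%R : R -> W -> W).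
  split=> [u'|u] a ? ? /=; first by rewrite scalerDl scalerA.
  by rewrite scalerDr !scalerA mulrC.
pose bm := bilinear_isBilinear.Build R R W W _ _ _ bS.
pose b : {bilinear R -> W -> W} := HB.pack ( *:%R : R -> W -> W) bm.
have dp := differentiable_pair df dg.
have db : differentiable (fun p : R * W => b p.1 p.2) (f x, g x).
  exact: differentiable_bilin.
split; first exact: (differentiable_comp dp db).
move=> v; rewrite (diff_comp dp db) /= (@diff_bilin _ _ _ _ b _ cS).
by rewrite (diff_pair df dg) /= addrC.
Qed.

Lemma CkZ W k U (f : V -> R) (g : V -> W) : open U -> Ck k U f -> Ck k U g ->
  Ck k U (fun x => f x *: g x).
Proof.
move=> oU; elim: k f g => [|k IH] f g.
  by move=> fc gc x Ux; apply: cvgZ; [exact: fc|exact: gc].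
move=> Cf Cg; have [df Cdf] := Cf; have [dg Cdg] := Cg; split=> [x Ux|v].
  by have [] := diff_scalep (df x Ux) (dg x Ux).
apply: (@Ck_eq _ _ _ (fun x => 'd f x v *: g x + f x *: 'd g x v)) => //.
  by move=> x Ux; have [_ ->] := diff_scalep (df x Ux) (dg x Ux).
apply: CkD => //; apply: IH.
- exact: Cdf.
- exact: CkW Cg.
- exact: CkW Cf.
- exact: Cdg.
Qed.

End Ck_theory.

Section Ck_linear.
Context {R : realType} {V V' W W' : normedModType R}.

(** Charts of a product are related to charts of the factors by linear
    projections and inclusions, so that the coordinate expressions below are
    compositions with linear maps on both sides. *)
Lemma diff_linear_comp (l : V' -> V) (m : W -> W') (f : V -> W) x :
  linear l -> continuous l -> linear m -> continuous m ->
  differentiable f (l x) ->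
  differentiable (fun y => m (f (l y))) x /\
  forall v, 'd (fun y => m (f (l y))) x v = m ('d f (l x) (l v)).
Proof.
move=> linl cl linm cm df.
have [dl dlE] := diff_linear x linl cl.
have [dm dmE] := diff_linear (f (l x)) linm cm.
have dfl : differentiable (f \o l) x by exact: differentiable_comp.
split; first exact: (differentiable_comp dfl dm).
move=> v; rewrite (_ : (fun y => _) = m \o (f \o l))//.
by rewrite (diff_comp dfl dm) (diff_comp dl df) /= dmE dlE.
Qed.

Lemma Ck_linear_comp k (l : V' -> V) (m : W -> W') (U : set V) (f : V -> W) :
  linear l -> continuous l -> linear m -> continuous m -> open U ->
  Ck k U f -> Ck k (l @^-1` U) (fun y => m (f (l y))).
Proof.
move=> linl cl linm cm oU.
have olU : open (l @^-1` U) by move/continuousP: cl; exact.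
elim: k f => [|k IH] f.
  move=> fc x Ux; apply: continuous_comp; last exact: cm.
  by apply: continuous_comp; [exact: cl|exact: fc].
move=> [df Cf]; split=> [x Ux|v].
  by have [] := diff_linear_comp linl cl linm cm (df _ Ux).
apply: Ck_eq (IH _ (Cf (l v))) => // x Ux.
by have [_ ->] := diff_linear_comp linl cl linm cm (df _ Ux).
Qed.

End Ck_linear.

Lemma id_clinear {R : realType} {V : normedModType R} :
  linear (id : V -> V) /\ continuous (id : V -> V).
Proof. by split=> // x; exact: cvg_id. Qed.

Section smooth_theory.
Context {R : realType} {V : normedModType R}.
Implicit Types (W : normedModType R) (U : set V).

Lemma smooth_diff W U (f : V -> W) x : smooth U f -> U x -> differentiable f x.
Proof. by move=> /(_ 1%N)/Ck_diff; exact. Qed.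

Lemma smooth_continuous W U (f : V -> W) x :
  smooth U f -> U x -> {for x, continuous f}.
Proof. by move=> /(_ 0%N); exact. Qed.

Lemma smooth_d W U (f : V -> W) v : smooth U f -> smooth U (fun x => 'd f x v).
Proof. by move=> sf k; have [_] := sf k.+1; exact. Qed.

Lemma smooth_eq W U (f g : V -> W) :
  open U -> (forall x, U x -> f x = g x) -> smooth U f -> smooth U g.
Proof. by move=> oU fg sf k; exact: Ck_eq (sf k). Qed.

Lemma smooth_local W U (f : V -> W) :
  (forall x, U x -> exists2 U', U' x & smooth U' f) -> smooth U f.
Proof. by move=> loc k; apply: Ck_local => x /loc [U' ? sf]; exists U'. Qed.

Lemma smooth_sub W U U' (f : V -> W) : U' `<=` U -> smooth U f -> smooth U' f.
Proof. by move=> sU sf k; exact: Ck_sub (sf k). Qed.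

Lemma smooth_cst W U (c : W) : smooth U (fun=> c).
Proof. by move=> k; exact: Ck_cst. Qed.

Lemma smoothD W U (f g : V -> W) : open U -> smooth U f -> smooth U g ->
  smooth U (fun x => f x + g x).
Proof. by move=> oU sf sg k; exact: CkD. Qed.

Lemma smoothZ W U (f : V -> R) (g : V -> W) : open U -> smooth U f ->
  smooth U g -> smooth U (fun x => f x *: g x).
Proof. by move=> oU sf sg k; exact: CkZ. Qed.

Lemma smooth_sum W U (I : Type) (r : seq I) (P : pred I) (f : I -> V -> W) :
  open U -> (forall i, P i -> smooth U (f i)) ->
  smooth U (fun x => \sum_(i <- r | P i) f i x).
Proof.
move=> oU sf; elim: r => [|i r IH].
  by under eq_fun do rewrite big_nil; exact: smooth_cst.
case Pi: (P i); under eq_fun do rewrite big_cons Pi; last exact: IH.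
by apply: smoothD => //; exact: sf.
Qed.

Lemma diff_sumE W (I : Type) (r : seq I) (f : I -> V -> W) x v :
  (forall i, smooth setT (f i)) ->
  'd (fun y => \sum_(i <- r) f i y) x v = \sum_(i <- r) 'd (f i) x v.
Proof.
move=> sf; elim: r => [|i r IH].
  by under eq_fun do rewrite big_nil; rewrite big_nil (diff_cst (0 : W) x).
under eq_fun do rewrite big_cons.
rewrite big_cons -IH; apply: diff_addE; first exact: smooth_diff (sf i) Logic.I.
apply: (@smooth_diff _ setT) => //; apply: smooth_sum => //; exact: openT.
Qed.

Lemma smoothM U (f g : V -> R) : open U -> smooth U f -> smooth U g ->
  smooth U (fun x => f x * g x).
Proof. exact: smoothZ. Qed.

Lemma smooth_prod U (I : Type) (r : seq I) (P : pred I) (f : I -> V -> R) :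
  open U -> (forall i, P i -> smooth U (f i)) ->
  smooth U (fun x => \prod_(i <- r | P i) f i x).
Proof.
move=> oU sf; elim: r => [|i r IH].
  by under eq_fun do rewrite big_nil; exact: smooth_cst.
case Pi: (P i); under eq_fun do rewrite big_cons Pi; last exact: IH.
by apply: smoothM => //; exact: sf.
Qed.

Lemma smoothV U (f : V -> R) : open U -> smooth U f ->
  (forall x, U x -> f x != 0) -> smooth U (fun x => (f x)^-1).
Proof.
move=> oU sf f0; elim=> [|k IH].
  by move=> x Ux; apply: continuousV; [exact: f0|exact: smooth_continuous sf Ux].
split=> [x Ux|v].
  by apply: differentiableV; [exact: smooth_diff sf Ux|exact: f0].
apply: (@Ck_eq _ _ _ _ _ (fun x => (- 'd f x v) * ((f x)^-1 * (f x)^-1))) => //.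
  move=> x Ux.
  have E : 'd (fun y => (f y)^-1) x v = - (f x) ^- 2 * 'd f x v.
    exact: (congr1 (fun h : V -> R => h v) (diffV (smooth_diff sf Ux) (f0 _ Ux))).
  by apply: etrans _ (esym E); rewrite -exprVn expr2 !mulNr mulrC.
apply: CkZ => //; last exact: CkZ.
rewrite (_ : (fun x => _) = fun x => (-1 : R) *: 'd f x v).
  by apply: CkZ => //; [exact: Ck_cst|exact: smooth_d].
by apply/funext => x; rewrite scaleN1r.
Qed.

End smooth_theory.

Lemma smooth_linear_comp {R : realType} {V V' W W' : normedModType R}
  (l : V' -> V) (m : W -> W') (U : set V) (f : V -> W) :
  linear l -> continuous l -> linear m -> continuous m -> open U ->
  smooth U f -> smooth (l @^-1` U) (fun y => m (f (l y))).
Proof.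
move=> ll cl lm cm oU sf k.
exact: (@Ck_linear_comp _ _ _ _ _ k l m U f ll cl lm cm oU (sf k)).
Qed.

Lemma smooth_linear_post {R : realType} {V W W' : normedModType R}
  (m : W -> W') (U : set V) (f : V -> W) :
  linear m -> continuous m -> open U -> smooth U f ->
  smooth U (fun y => m (f y)).
Proof.
have [lid cid] := @id_clinear R V; move=> lm cm oU sf.
exact: (@smooth_linear_comp _ _ _ _ _ id m U f lid cid lm cm oU sf).
Qed.

Lemma smooth_linear {R : realType} {V W : normedModType R} (l : V -> W) :
  linear l -> continuous l -> smooth setT l.
Proof.
move=> ll cl k.
have [lid cid] := @id_clinear R V.
have Ci : Ck k setT (@id V).
  case: k => [|k]; first by move=> x _; exact: cvg_id.
  split=> [x _|v]; first by have [] := diff_linear x lid cid.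
  apply: (@Ck_eq _ _ _ _ _ (fun=> v)); [exact: openT| |exact: Ck_cst].
  by move=> x _; have [_ ->] := diff_linear x lid cid.
exact: (@Ck_linear_comp _ _ _ _ _ _ id l setT id lid cid ll cl openT Ci).
Qed.

(** * Matrix-valued maps and the symmetry of second derivatives *)

Section matrix_valued.
Context {R : realType} {V : normedModType R} {m n : nat}.
Implicit Types (U : set V) (f : V -> 'M[R]_(m, n)).

Lemma linear_coord (i : 'I_m) (j : 'I_n) :
  linear (fun A : 'M[R]_(m, n) => A i j).
Proof. by move=> a A B; rewrite !mxE. Qed.

Lemma smooth_coord U f i j : open U -> smooth U f ->
  smooth U (fun x => f x i j).
Proof.
move=> oU sf.
apply: (@smooth_linear_post _ _ _ _ (fun A : 'M[R]_(m, n) => A i j)) => //.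
  exact: linear_coord.
exact: coord_continuous.
Qed.

Lemma smooth_mx U f : open U -> (forall i j, smooth U (fun x => f x i j)) ->
  smooth U f.
Proof.
move=> oU sf.
rewrite (_ : f = fun x => \sum_i \sum_j f x i j *: delta_mx i j); last first.
  by apply/funext => x; exact: matrix_sum_delta.
apply: smooth_sum => // i _; apply: smooth_sum => // j _.
by apply: smoothZ => //; exact: smooth_cst.
Qed.

Lemma diff_coord f i j x v : differentiable f x ->
  'd (fun y => f y i j) x v = 'd f x v i j.
Proof.
move=> df; have [lid cid] := @id_clinear R V.
have [_ ->//] := @diff_linear_comp _ _ _ _ _ id (fun A : 'M[R]_(m, n) => A i j)
  f x lid cid (linear_coord _ _) (@coord_continuous _ _ _ _ _) df.
Qed.

End matrix_valued.

Lemma linear_row_basis {R : realType} {n : nat} {W : normedModType R}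
  (L : {linear 'rV[R]_n -> W}) (v : 'rV[R]_n) :
  L v = \sum_i v 0 i *: L (delta_mx 0 i).
Proof.
rewrite {1}(row_sum_delta v) linear_sum.
by apply: eq_bigr => i _; rewrite linearZ.
Qed.

Section matrix_product.
Context {R : realType} {V : normedModType R}.

Lemma smooth_mulmx m n p (U : set V) (f : V -> 'M[R]_(m, n))
    (g : V -> 'M[R]_(n, p)) : open U -> smooth U f -> smooth U g ->
  smooth U (fun x => f x *m g x).
Proof.
move=> oU sf sg; apply: smooth_mx => // i j; under eq_fun do rewrite mxE.
by apply: smooth_sum => // k _; apply: smoothM => //; exact: smooth_coord.
Qed.

Lemma smooth_trmx m n (U : set V) (f : V -> 'M[R]_(m, n)) :
  open U -> smooth U f -> smooth U (fun x => (f x)^T).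
Proof.
move=> oU sf; apply: smooth_mx => // i j; under eq_fun do rewrite mxE.
exact: smooth_coord.
Qed.

Lemma smooth_det n (U : set V) (f : V -> 'M[R]_n) : open U -> smooth U f ->
  smooth U (fun x => \det (f x)).
Proof.
move=> oU sf; apply: smooth_sum => // s _; apply: smoothM => //.
  exact: smooth_cst.
by apply: smooth_prod => // i _; exact: smooth_coord.
Qed.

(** Cramer's rule makes the inverse matrix a rational function of the
    entries. *)
Lemma smooth_invmx n (U : set V) (f : V -> 'M[R]_n) : open U -> smooth U f ->
  (forall x, U x -> f x \in unitmx) -> smooth U (fun x => invmx (f x)).
Proof.
move=> oU sf uf.
apply: (@smooth_eq _ _ _ _ (fun x => (\det (f x))^-1 *: \adj (f x))) => //.
  by move=> x Ux; rewrite /invmx uf.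
apply: smoothZ => //.
  apply: smoothV => //; first exact: smooth_det.
  by move=> x /uf; rewrite unitmxE unitfE.
apply: smooth_mx => // i j; under eq_fun do rewrite mxE.
apply: smoothM => //; first exact: smooth_cst.
apply: smooth_det => //; apply: smooth_mx => // k l.
by under eq_fun do rewrite !mxE; exact: smooth_coord.
Qed.

Lemma diff_mulmx m n p (f : V -> 'M[R]_(m, n)) (g : V -> 'M[R]_(n, p)) x v :
  smooth setT f -> smooth setT g ->
  'd (fun y => f y *m g y) x v = 'd f x v *m g x + f x *m 'd g x v.
Proof.
move=> sf sg; apply/matrixP => i j.
have df := smooth_diff sf (I : setT x); have dg := smooth_diff sg (I : setT x).
rewrite -diff_coord; last exact: (smooth_diff (smooth_mulmx openT sf sg) I).
have sfg k : smooth setT (fun y => f y i k * g y k j).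
  by apply: smoothM; [exact: openT|exact: (smooth_coord _ _ openT sf)|
    exact: (smooth_coord _ _ openT sg)].
rewrite (_ : (fun y => _) = fun y => \sum_k f y i k * g y k j); last first.
  by apply/funext => y; rewrite mxE.
rewrite (diff_sumE _ _ _ sfg).
rewrite !mxE -big_split; apply: eq_bigr => k _ /=.
have dfc : differentiable (fun y => f y i k) x.
  exact: (smooth_diff (smooth_coord _ _ openT sf) I).
have dgc : differentiable (fun y => g y k j) x.
  exact: (smooth_diff (smooth_coord _ _ openT sg) I).
by have [_ ->] := diff_scalep dfc dgc; rewrite !diff_coord.
Qed.

End matrix_product.

Section mean_value.
Context {R : realType} {V : normedModType R}.

Lemma mean_value_dir (f : V -> R) (a v : V) (s : R) :
  (forall x, differentiable f x) -> 0 < s ->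
  exists2 c, c \in `]0, s[%R & f (a + s *: v) - f a = s * 'd f (a + c *: v) v.
Proof.
move=> df s0.
have dl (t : R) : is_diff t (fun t : R => a + t *: v) (fun t => t *: v).
  by apply: is_diff_eq; rewrite add0r.
have ddl t : differentiable (fun t : R => a + t *: v) t by exact: ex_diff.
have dphi (t : R) : is_derive t 1 (fun t => f (a + t *: v)) ('d f (a + t *: v) v).
  have dc : differentiable (f \o (fun t : R => a + t *: v)) t.
    by apply: differentiable_comp; [|exact: df].
  apply: DeriveDef; first exact: diff_derivable dc.
  rewrite (deriveE _ dc).
  have E := @diff_compE _ _ _ _ (fun t : R => a + t *: v) f t 1 (ddl t) (df _).
  by apply: (etrans E); rewrite diff_val scale1r.
have [|c cs] := @MVT R (fun t => f (a + t *: v)) _ 0 s s0 (fun x _ => dphi x).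
  apply: continuous_subspaceT => t; apply: differentiable_continuous.
  by apply/derivable1_diffP; have [] := dphi t.
by rewrite scale0r addr0 subr0 mulrC => ?; exists c.
Qed.

(** The mean value theorem in the direction [v] for the increment of [f] by [s
    *: w], and then in the direction [w]. *)
Lemma second_difference (f : V -> R) (x v w : V) (s : R) :
  smooth setT f -> 0 < s ->
  exists c d, [/\ c \in `]0, s[%R, d \in `]0, s[%R &
    f (x + s *: v + s *: w) - f (x + s *: v) - (f (x + s *: w) - f x)
    = s * (s * 'd (fun y => 'd f y v) (x + c *: v + d *: w) w)].
Proof.
move=> sf s0.
have df y : differentiable f y by exact: smooth_diff sf I.
have dfv y : differentiable (fun y => 'd f y v) y.
  exact: (smooth_diff (smooth_d v sf) I).
have shift_diff y : is_diff y (fun y => y + s *: w) id.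
  by apply: is_diff_eq; rewrite addr0.
have dds y : differentiable (fun y : V => y + s *: w) y by exact: ex_diff.
have dfs y : differentiable (f \o (fun y => y + s *: w)) y.
  by apply: differentiable_comp; [|exact: df].
have dg y : differentiable (fun y => f (y + s *: w) - f y) y.
  by apply: differentiableB; [exact: dfs|exact: df].
have [c cs Hc] := @mean_value_dir _ x v s dg s0.
have [d ds Hd] := @mean_value_dir _ (x + c *: v) w s dfv s0.
exists c, d; split => //.
rewrite (addrAC x (s *: v)) in Hc *.
rewrite -Hd -[RHS](_ : s * 'd (fun y => f (y + s *: w) - f y) (x + c *: v) v = _).
  by rewrite -Hc addrAC.
have := congr1 (fun h : V -> R => h v) (diffB (dfs (x + c *: v)) (df (x + c *: v))).
move=> /= E; congr (_ * _); apply: (etrans E); congr (_ - _).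
have E' := @diff_compE _ _ _ _ (fun y : V => y + s *: w) f (x + c *: v) v
  (dds _) (df _).
by apply: (etrans E'); rewrite diff_val.
Qed.

(** Schwarz's theorem: the second difference of [f] is symmetric in [v] and
    [w], and divided by [s ^+ 2] it is a value, at points tending to [x], of
    each of the two mixed derivatives, which are continuous. *)
Lemma diff_sym (f : V -> R) (x v w : V) : smooth setT f ->
  'd (fun y => 'd f y v) x w = 'd (fun y => 'd f y w) x v.
Proof.
move=> sf.
set h1 := fun y => 'd (fun y => 'd f y v) y w.
set h2 := fun y => 'd (fun y => 'd f y w) y v.
have c1 : {for x, continuous h1}.
  exact: (smooth_continuous (smooth_d w (smooth_d v sf)) I).
have c2 : {for x, continuous h2}.
  exact: (smooth_continuous (smooth_d v (smooth_d w sf)) I).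
rewrite -/(h1 x) -/(h2 x).
apply/eqP; rewrite -subr_eq0 -normr_le0; apply/ler_addgt0Pl => e e0; rewrite addr0.
have e20 : 0 < e / 2 by rewrite divr_gt0.
have /nbhs_ballP [r /= r0 Hr] : \forall y \near x,
    `|h1 x - h1 y| < e / 2 /\ `|h2 x - h2 y| < e / 2.
  near=> y; split; near: y.
    by move/cvgrPdist_lt : c1; apply.
  by move/cvgrPdist_lt : c2; apply.
(* The mixed derivatives given by the second difference of step [s] are taken
   at points within [s * (`|v| + `|w|)] of [x]. *)
pose N := `|v| + `|w| + 1.
have N0 : 0 < N by rewrite /N ltr_wpDl// addr_ge0.
pose s := r / N.
have s0 : 0 < s by rewrite divr_gt0.
have Hball (c d : R) v' w' : `|v'| + `|w'| + 1 = N ->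
    c \in `]0, s[%R -> d \in `]0, s[%R ->
    ball x r (x + c *: v' + d *: w').
  move=> NE; rewrite !in_itv /= => /andP[c0 cs] /andP[d0 ds].
  rewrite -ball_normE /= -addrA opprD addNKr normrN.
  apply: (le_lt_trans (ler_normD _ _)); rewrite !normrZ !gtr0_norm//.
  rewrite (_ : r = s * N); last by rewrite /s divfK ?gt_eqF.
  rewrite -NE mulrDr mulr1 mulrDr (le_lt_trans (y := s * `|v'| + s * `|w'|))//.
    by rewrite lerD// ler_wpM2r// ltW.
  by rewrite ltrDl.
have [c [d [cs ds Hcd]]] := second_difference x v w sf s0.
have [c' [d' [cs' ds' Hcd']]] := second_difference x w v sf s0.
have h12 : h1 (x + c *: v + d *: w) = h2 (x + c' *: w + d' *: v).
  apply: (mulfI (lt0r_neq0 s0)); apply: (mulfI (lt0r_neq0 s0)).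
  rewrite -Hcd -Hcd' (addrAC x (s *: v)).
  by ring.
have [h1x _] := Hr _ (Hball _ _ _ _ erefl cs ds).
have [|_ h2x] := Hr _ (Hball c' d' w v _ cs' ds'); first by rewrite /N (addrC `|w|).
rewrite -(subrKA (h1 (x + c *: v + d *: w))) {2}h12.
apply: (le_trans (ler_normD _ _)); rewrite (splitr e) lerD ?ltW//.
by rewrite distrC.
Unshelve. all: by end_near. Qed.

End mean_value.

Lemma diff_sym_rV {R : realType} {n p} (f : 'rV[R]_n -> 'rV[R]_p) x v w :
  smooth setT f ->
  'd (fun y => 'd f y v) x w = 'd (fun y => 'd f y w) x v.
Proof.
move=> sf; apply/rowP => j.
have df y : differentiable f y by exact: smooth_diff sf I.
have dE u u' : 'd (fun y => 'd f y u) x u' 0 j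
    = 'd (fun y => 'd (fun z => f z 0 j) y u) x u'.
  rewrite -(diff_coord 0 j u' (smooth_diff (smooth_d u sf) (I : setT x))).
  by congr ('d _ x u'); apply/funext => y; rewrite diff_coord.
rewrite !dE; apply: diff_sym; exact: smooth_coord openT sf.
Qed.

Lemma diff0_cst {R : realType} {n p} (f : 'rV[R]_n -> 'rV[R]_p) :
  smooth setT f -> (forall x v, 'd f x v = 0) -> forall x, f x = f 0.
Proof.
move=> sf df0 x; apply/rowP => j.
have df y : differentiable (fun y => f y 0 j) y.
  exact: (smooth_diff (smooth_coord _ _ openT sf) I).
have [c _] := @mean_value_dir _ _ (fun y => f y 0 j) 0 x 1 df ltr01.
rewrite add0r scale1r diff_coord; last exact: smooth_diff sf I.
by rewrite df0 mxE mulr0 => /eqP; rewrite subr_eq0 => /eqP.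
Qed.

(** * Dually flat structures of Hessian metrics *)

Section flat_connection.
Context {R : realType} {n : nat}.
Implicit Types (X Y Z : vfield R n) (p v w : 'rV[R]_n).

Lemma diff_jacobian (f : vfield R n) p v : 'd f p v = v *m jacobian f p.
Proof. by rewrite /jacobian mul_rV_lin1. Qed.

Lemma smooth_jacobian (f : vfield R n) :
  smooth setT f -> smooth setT (jacobian f).
Proof.
move=> sf; apply: smooth_mx => [|i j]; first exact: openT.
under eq_fun do rewrite mxE.
apply: (@smooth_coord _ _ _ _ _ (fun x => 'd f x (delta_mx 0 i))).
  exact: openT.
exact: smooth_d.
Qed.

Lemma smooth_nabla_flat X Y :
  smooth setT X -> smooth setT Y -> smooth setT (nabla_flat X Y).
Proof.
move=> sX sY; rewrite (_ : nabla_flat X Y = fun p => X p *m jacobian Y p).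
  by apply: smooth_mulmx => //; [exact: openT|exact: smooth_jacobian].
by apply/funext => p; rewrite /nabla_flat diff_jacobian.
Qed.

(** The last term is the second derivative of [Y] in the directions [v] and [X
    p], which is the symmetric part. *)
Lemma diff_nabla_flat X Y p v : smooth setT X -> smooth setT Y ->
  'd (nabla_flat X Y) p v
  = 'd Y p ('d X p v) + 'd (fun q => 'd Y q (X p)) p v.
Proof.
move=> sX sY; have sJ := smooth_jacobian sY.
have E1 := diff_mulmx p v sX sJ.
have E2 := diff_mulmx p v (smooth_cst setT (X p)) sJ.
have {}E2 : 'd (fun q => 'd Y q (X p)) p v = X p *m 'd (jacobian Y) p v.
  transitivity ('d (fun q => X p *m jacobian Y q) p v).
    by congr ('d _ p v); apply/funext => q; exact: diff_jacobian.
  by apply: (etrans E2); rewrite (diff_cst (X p) p) mul0mx add0r.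
transitivity ('d (fun q => X q *m jacobian Y q) p v).
  by congr ('d _ p v); apply/funext => q; exact: diff_jacobian.
apply: (etrans E1); congr (_ + _); last exact: esym.
by apply/esym; exact: diff_jacobian.
Qed.

Lemma nabla_flat_connection : is_connection (@nabla_flat R n).
Proof.
split.
- exact: smooth_nabla_flat.
- by move=> X X' Y p _ _ _; rewrite /nabla_flat linearD.
- by move=> f X Y p _ _ _; rewrite /nabla_flat linearZ.
- move=> X Y Y' p _ sY sY'; apply: diff_addE.
    exact: smooth_diff sY I.
  exact: smooth_diff sY' I.
- move=> f X Y p sf _ sY.
  exact: (diff_scalep (smooth_diff sf I) (smooth_diff sY I)).2.
Qed.

(** The curvature is the antisymmetric part of a second derivative, the terms
    that differentiate [X] and [Y] being compensated by the Lie bracket. *)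
Lemma nabla_flat_flat : is_flat (@nabla_flat R n).
Proof.
split=> [X Y p _ _|X Y Z p sX sY sZ].
  by rewrite /nabla_flat /lie_bracket subrr.
have EX := diff_nabla_flat p (X p) sY sZ.
have EY := diff_nabla_flat p (Y p) sX sZ.
have ES := diff_sym_rV p (Y p) (X p) sZ.
rewrite [X in X - _ - _]EX [X in _ - X - _]EY [X in _ + X - _ - _]ES.
rewrite opprD addrACA subrr addr0; apply/eqP; rewrite subr_eq0; apply/eqP.
exact/esym/(linearB ('d Z p)).
Qed.

End flat_connection.

Section dual_connection.
Context {R : realType} {n : nat} (h : 'rV[R]_n -> 'M[R]_n).
Hypothesis h_riem : is_riemannian h.
(* The Codazzi equation. *)
Hypothesis codazzi : forall p u v, v *m 'd h p u = u *m 'd h p v.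

Let sh : smooth setT h := h_riem.1.

(** A vector in the kernel of a positive definite form would have norm zero.
    *)
Lemma posdef_unitmx (A : 'M[R]_n) : posdef A -> A \in unitmx.
Proof.
move=> [_ Apos]; rewrite -row_free_unit -kermx_eq0; apply/rowV0P => v.
move=> /sub_kermxP vA; apply/eqP; apply: contraT => /Apos.
by rewrite /mform vA mul0mx mxE ltxx.
Qed.

Let hu p : h p \in unitmx. Proof. exact: posdef_unitmx (h_riem.2 p). Qed.
Let hT p : (h p)^T = h p. Proof. by have [] := h_riem.2 p. Qed.

(** [h] identifies vector fields with 1-forms; the dual connection is the
    transport of the flat connection by this identification. *)
Definition dual_nabla (X Z : vfield R n) : vfield R n :=
  fun p => nabla_flat X (fun q => Z q *m h q) p *m invmx (h p).

Let smulh (Z : vfield R n) : smooth setT Z -> smooth setT (fun q => Z q *m h q).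
Proof. by move=> sZ; apply: smooth_mulmx => //; exact: openT. Qed.

Let dual_nabla_h (X Z : vfield R n) :
  (fun q => dual_nabla X Z q *m h q) = nabla_flat X (fun q => Z q *m h q).
Proof. by apply/funext => q; rewrite mulmxKV. Qed.

Lemma dual_nabla_connection : is_connection dual_nabla.
Proof.
have [N1 N2 N3 N4 N5] := @nabla_flat_connection R n.
split.
- move=> X Y sX sY; apply: smooth_mulmx; first exact: openT.
    exact: (N1 _ _ sX (smulh sY)).
  by apply: smooth_invmx => [||p _]; [exact: openT|exact: sh|exact: hu].
- move=> X X' Y p sX sX' sY.
  by rewrite /dual_nabla (N2 _ _ _ _ sX sX' (smulh sY)) mulmxDl.
- move=> f X Y p sf sX sY.
  by rewrite /dual_nabla (N3 _ _ _ _ sf sX (smulh sY)) -scalemxAl.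
- move=> X Y Y' p sX sY sY'; rewrite /dual_nabla.
  have -> : (fun q => (Y q + Y' q) *m h q) = fun q => Y q *m h q + Y' q *m h q.
    by apply/funext => q; rewrite mulmxDl.
  by rewrite (N4 _ _ _ _ sX (smulh sY) (smulh sY')) mulmxDl.
- move=> f X Y p sf sX sY; rewrite /dual_nabla.
  have -> : (fun q => (f q *: Y q) *m h q) = fun q => f q *: (Y q *m h q).
    by apply/funext => q; rewrite scalemxAl.
  by rewrite (N5 _ _ _ _ sf sX (smulh sY)) mulmxDl -!scalemxAl mulmxK.
Qed.

Lemma dual_nabla_dual : is_dual h (@nabla_flat R n) dual_nabla.
Proof.
move=> X Y Z p sX sY sZ; rewrite /mform.
have sZT : smooth setT (fun q => (Z q *m h q)^T).
  by apply: smooth_trmx; [exact: openT|exact: smulh].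
rewrite (_ : (fun q => _) = fun q => (Y q *m (Z q *m h q)^T) 0 0); last first.
  by apply/funext => q; rewrite trmx_mul hT mulmxA.
have sYZ := smooth_mulmx openT sY sZT.
apply: (etrans (diff_coord 0 0 (X p) (smooth_diff sYZ (I : setT p)))).
have E := diff_mulmx p (X p) sY sZT.
apply: (etrans (congr1 (fun A : 'M[R]_1 => A 0 0) E)); rewrite mxE; congr (_ + _).
  by rewrite trmx_mul hT mulmxA.
rewrite /dual_nabla trmx_mul trmx_inv hT mulmxA mulmxK// /nabla_flat.
congr ((_ *m _) 0 0); apply/matrixP => i j.
rewrite -(diff_coord i j (X p) (smooth_diff sZT (I : setT p))) mxE.
rewrite -(diff_coord j i (X p) (smooth_diff (smulh sZ) (I : setT p))).
by congr ('d _ p (X p)); apply/funext => q; rewrite mxE.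
Qed.

(** The torsion comes from the antisymmetric part of the derivative of [h], and
    the curvature is conjugate by [h] to that of the flat connection. *)
Lemma dual_nabla_flat : is_flat dual_nabla.
Proof.
split=> [X Y p sX sY|X Y Z p sX sY sZ].
  have EX := diff_mulmx p (X p) sY sh; have EY := diff_mulmx p (Y p) sX sh.
  rewrite /dual_nabla [X in X *m _ - _]EX [X in _ - X *m _ - _]EY.
  rewrite !mulmxDl !mulmxK// /lie_bracket.
  by rewrite (codazzi p (X p)) opprD addrACA subrr addr0 subrr.
rewrite -!mulmxBl.
have [_ F] := @nabla_flat_flat R n.
have -> : nabla_flat X (fun q => dual_nabla Y Z q *m h q) p
  - nabla_flat Y (fun q => dual_nabla X Z q *m h q) p
  - nabla_flat (lie_bracket X Y) (fun q => Z q *m h q) p = 0.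
  by rewrite !dual_nabla_h; apply: F => //; exact: smulh.
by rewrite mul0mx.
Qed.

Lemma codazzi_dually_flat : dually_flat h nabla_flat.
Proof.
split => //; [exact: nabla_flat_connection|exact: nabla_flat_flat|].
exists dual_nabla; split; [exact: dual_nabla_connection|exact: dual_nabla_dual|].
exact: dual_nabla_flat.
Qed.

End dual_connection.

Section hessian.
Context {R : realType} {n : nat} (psi : 'rV[R]_n -> R).
Hypothesis spsi : smooth setT psi.

Lemma hessE p i j : hess psi p i j
  = 'd (fun y => 'd psi y (delta_mx 0 j)) p (delta_mx 0 i).
Proof.
rewrite mxE deriveE.
  congr ('d _ p _); apply/funext => y; rewrite deriveE//.
  exact: smooth_diff spsi I.
rewrite (_ : 'D_(delta_mx 0 j) psi = fun y => 'd psi y (delta_mx 0 j)).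
  exact: smooth_diff (smooth_d _ spsi) I.
by apply/funext => y; rewrite deriveE//; exact: smooth_diff spsi I.
Qed.

Lemma smooth_hess : smooth setT (hess psi).
Proof.
apply: smooth_mx => [|i j]; first exact: openT.
by under eq_fun do rewrite hessE; do 2 apply: smooth_d.
Qed.

(** The coordinate-free expression of the Hessian shows how it behaves under
    linear maps. *)
Lemma mform_hess p v w : mform (hess psi p) v w = 'd (fun y => 'd psi y w) p v.
Proof.
pose g j y := w 0 j *: 'd psi y (delta_mx 0 j).
have sg j : smooth setT (g j).
  by apply: smoothZ; [exact: openT|exact: smooth_cst|exact: smooth_d].
have dg j : 'd (g j) p v
    = w 0 j * 'd (fun y => 'd psi y (delta_mx 0 j)) p v.
  exact: (@diff_scaleE _ _ _ _ _ p v (smooth_diff (smooth_d _ spsi) I)).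
have -> : (fun y => 'd psi y w) = fun y => \sum_j g j y.
  by apply/funext => y; rewrite linear_row_basis.
rewrite (diff_sumE _ p v sg) /mform mxE; apply: eq_bigr => j _.
have -> : w^T j 0 = w 0 j by rewrite mxE.
rewrite dg mulrC; congr (_ * _); rewrite mxE linear_row_basis.
by apply: eq_bigr => i _; rewrite hessE.
Qed.

(** The entries of both sides are third derivatives of [psi] in the directions
    [u], [v] and a basis vector. *)
Lemma hess_codazzi p u v : v *m 'd (hess psi) p u = u *m 'd (hess psi) p v.
Proof.
have E a b : a *m 'd (hess psi) p b
    = \row_j 'd (fun q => 'd (fun y => 'd psi y (delta_mx 0 j)) q a) p b.
  have sc : smooth setT (fun q => a *m hess psi q).
    by apply: smooth_mulmx; [exact: openT|exact: smooth_cst|exact: smooth_hess].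
  apply/rowP => j; rewrite [RHS]mxE.
  have -> : a *m 'd (hess psi) p b = 'd (fun q => a *m hess psi q) p b.
    apply/esym/(etrans (diff_mulmx p b (smooth_cst setT a) smooth_hess)).
    by rewrite (diff_cst a p) mul0mx add0r.
  rewrite -(diff_coord 0 j b (smooth_diff sc (I : setT p))).
  congr ('d _ p b); apply/funext => q; rewrite -mform_hess /mform.
  by rewrite trmx_delta -colE [RHS]mxE.
by rewrite !E; apply/rowP => j; rewrite !mxE; apply: diff_sym; apply: smooth_d.
Qed.

Lemma hess_dually_flat : (forall p, posdef (hess psi p)) ->
  dually_flat (hess psi) nabla_flat.
Proof.
move=> pd; apply: codazzi_dually_flat; last exact: hess_codazzi.
by split=> //; exact: smooth_hess.
Qed.

End hessian.

(** * Maps that split in local charts *)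

Lemma pair_continuous {T A B : topologicalType} (f : T -> A) (g : T -> B) :
  continuous f -> continuous g -> continuous (fun x => (f x, g x)).
Proof. by move=> cf cg x; apply: cvg_pair; [exact: cf|exact: cg]. Qed.

Lemma comp_continuous {T A B : topologicalType} (f : T -> A) (g : A -> B) :
  continuous f -> continuous g -> continuous (fun x => g (f x)).
Proof. by move=> cf cg x; apply: continuous_comp; [exact: cf|exact: cg]. Qed.

Lemma fst_continuous {A B : topologicalType} : continuous (@fst A B).
Proof. by move=> x; exact: cvg_fst. Qed.

Lemma snd_continuous {A B : topologicalType} : continuous (@snd A B).
Proof. by move=> x; exact: cvg_snd. Qed.

Section TR_linear.
Context {R : realType} {n1 n2 : nat}.

Lemma row_mx_continuous m k :
  continuous (fun p : 'M[R]_(m, n1) * 'M[R]_(m, k) => row_mx p.1 p.2).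
Proof.
move=> [u v] A /nbhs_ballP[e /= e0 eA].
apply/nbhs_ballP; exists e => //= -[u' v'] [/= [_ uu'] [_ vv']].
apply: eA; split => // i j; rewrite !mxE.
by case: (fintype.split j) => j'; [exact: uu'|exact: vv'].
Qed.

Lemma TR_left_clinear :
  linear (@TR_left R n1 n2) /\ continuous (@TR_left R n1 n2).
Proof.
split; first by move=> c a b; rewrite /TR_left /= !linearP.
apply: pair_continuous; apply: comp_continuous (@continuous_lsubmx _ _ _ _).
  exact: fst_continuous.
exact: snd_continuous.
Qed.

Lemma TR_right_clinear :
  linear (@TR_right R n1 n2) /\ continuous (@TR_right R n1 n2).
Proof.
split; first by move=> c a b; rewrite /TR_right /= !linearP.
apply: pair_continuous; apply: comp_continuous (@continuous_rsubmx _ _ _ _).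
  exact: fst_continuous.
exact: snd_continuous.
Qed.

Lemma TR_join_continuous :
  continuous (fun p : TR R n1 * TR R n2 => TR_join p.1 p.2).
Proof.
apply: pair_continuous;
  apply: (comp_continuous (f := fun p => (_, _)) _ (@row_mx_continuous _ _));
  apply: pair_continuous.
- exact: comp_continuous (@fst_continuous _ _) (@fst_continuous _ _).
- exact: comp_continuous (@snd_continuous _ _) (@fst_continuous _ _).
- exact: comp_continuous (@fst_continuous _ _) (@snd_continuous _ _).
- exact: comp_continuous (@snd_continuous _ _) (@snd_continuous _ _).
Qed.

Lemma TR_joinl_clinear : linear (fun u : TR R n1 => TR_join u (0 : TR R n2)) /\
  continuous (fun u : TR R n1 => TR_join u (0 : TR R n2)).
Proof.
split.
  move=> c a b; apply: injective_projections;
  by rewrite /= scale_row_mx add_row_mx scaler0 addr0.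
apply: (@comp_continuous _ _ _ (fun u : TR R n1 => (u, 0 : TR R n2)) _ _
  TR_join_continuous).
by apply: pair_continuous => x; [exact: cvg_id|exact: cvg_cst].
Qed.

Lemma TR_joinr_clinear : linear (fun u : TR R n2 => TR_join (0 : TR R n1) u) /\
  continuous (fun u : TR R n2 => TR_join (0 : TR R n1) u).
Proof.
split.
  move=> c a b; apply: injective_projections;
  by rewrite /= scale_row_mx add_row_mx scaler0 addr0.
apply: (@comp_continuous _ _ _ (fun u : TR R n2 => (0 : TR R n1, u)) _ _
  TR_join_continuous).
by apply: pair_continuous => x; [exact: cvg_cst|exact: cvg_id].
Qed.

Lemma TR_joinE (u : TR R n1) (v : TR R n2) :
  TR_join u v = TR_join u 0 + TR_join 0 v.
Proof. by apply: injective_projections; rewrite /= add_row_mx addr0 add0r. Qed.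

Lemma TR_joinKl (u : TR R n1) (v : TR R n2) : TR_left (TR_join u v) = u.
Proof. by case: u => u u'; rewrite /TR_left /= !row_mxKl. Qed.

Lemma TR_joinKr (u : TR R n1) (v : TR R n2) : TR_right (TR_join u v) = v.
Proof. by case: v => v v'; rewrite /TR_right /= !row_mxKr. Qed.

Lemma TR_joinK (u : TR R (n1 + n2)) : TR_join (TR_left u) (TR_right u) = u.
Proof. by case: u => u u'; rewrite /TR_join /= !hsubmxK. Qed.

Lemma TR_left_J (u : TR R (n1 + n2)) : TR_left (cplxJ u) = cplxJ (TR_left u).
Proof. by rewrite /TR_left /cplxJ /= linearN. Qed.

Lemma TR_right_J (u : TR R (n1 + n2)) : TR_right (cplxJ u) = cplxJ (TR_right u).
Proof. by rewrite /TR_right /cplxJ /= linearN. Qed.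

Lemma TR_join_J (u : TR R n1) (v : TR R n2) :
  cplxJ (TR_join u v) = TR_join (cplxJ u) (cplxJ v).
Proof. by rewrite /TR_join /cplxJ /= opp_row_mx. Qed.

Section join_maps.
Context {V V1 V2 : normedModType R} (l1 : V -> V1) (l2 : V -> V2).
Hypotheses (l1P : linear l1 /\ continuous l1) (l2P : linear l2 /\ continuous l2).
Variables (f1 : V1 -> TR R n1) (f2 : V2 -> TR R n2).

Lemma smooth_join U1 U2 : open U1 -> open U2 -> smooth U1 f1 -> smooth U2 f2 ->
  smooth (l1 @^-1` U1 `&` l2 @^-1` U2)
    (fun x => TR_join (f1 (l1 x)) (f2 (l2 x))).
Proof.
move=> oU1 oU2 s1 s2; have [ll1 cl1] := l1P; have [ll2 cl2] := l2P.
have [ml mcl] := TR_joinl_clinear; have [mr mcr] := TR_joinr_clinear.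
have o1 : open (l1 @^-1` U1) by move/continuousP: cl1; exact.
have o2 : open (l2 @^-1` U2) by move/continuousP: cl2; exact.
rewrite (_ : (fun x => _) =
  fun x => TR_join (f1 (l1 x)) 0 + TR_join 0 (f2 (l2 x))); last first.
  by apply/funext => x; exact: TR_joinE.
apply: smoothD; first exact: openI.
  apply: smooth_sub (@subIsetl _ _ _) _.
  exact: (smooth_linear_comp ll1 cl1 ml mcl oU1 s1).
apply: smooth_sub (@subIsetr _ _ _) _.
exact: (smooth_linear_comp ll2 cl2 mr mcr oU2 s2).
Qed.

Lemma diff_join x : differentiable f1 (l1 x) -> differentiable f2 (l2 x) ->
  differentiable (fun x => TR_join (f1 (l1 x)) (f2 (l2 x))) x /\
  forall a, 'd (fun x => TR_join (f1 (l1 x)) (f2 (l2 x))) x a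
    = TR_join ('d f1 (l1 x) (l1 a)) ('d f2 (l2 x) (l2 a)).
Proof.
move=> d1 d2; have [ll1 cl1] := l1P; have [ll2 cl2] := l2P.
have [ml mcl] := TR_joinl_clinear; have [mr mcr] := TR_joinr_clinear.
have [e1 E1] := diff_linear_comp ll1 cl1 ml mcl d1.
have [e2 E2] := diff_linear_comp ll2 cl2 mr mcr d2.
rewrite (_ : (fun x => _) =
  fun x => TR_join (f1 (l1 x)) 0 + TR_join 0 (f2 (l2 x))); last first.
  by apply/funext => y; exact: TR_joinE.
split; first exact: differentiableD.
move=> a; apply: (etrans (diff_addE a e1 e2)).
apply: (etrans (congr2 +%R (E1 a) (E2 a))).
by apply/esym; exact: TR_joinE.
Qed.

End join_maps.
End TR_linear.

Section atlases.
Context {R : realType}.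

Definition good_atlas {V : normedModType R} {T : topologicalType}
    (A : atlas V T) : Prop :=
  forall i : chart_index A,
    [/\ open (chart_dom i), open (chart_img i),
        forall P, chart_dom i P ->
          {for P, continuous (chart i)} /\ chart_inv i (chart i P) = P &
        forall x, chart_img i x ->
          {for x, continuous (chart_inv i)} /\ chart_dom i (chart_inv i x)].

Lemma chart_imgK {V : normedModType R} {T : topologicalType} (A : atlas V T)
    (i : chart_index A) x : good_atlas A -> chart_img i x ->
  chart i (chart_inv i x) = x.
Proof. by move=> gA [P iP <-]; have [_ _ /(_ P iP)[_ ->]] := gA i. Qed.

Lemma coord_dom_open {V V' : normedModType R} {T T' : topologicalType}
    (A : atlas V T) (A' : atlas V' T') (U : set T) (f : T -> T') i j :
  good_atlas A -> good_atlas A' -> open U ->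
  (forall P, U P -> {for P, continuous f}) ->
  open (coord_dom (A := A) (A' := A') U f i j).
Proof.
move=> gA gA' oU cf; rewrite openE => x [ix Ux jx].
have [_ oimg _ /(_ x ix)[cinv _]] := gA i; have [oj _ _ _] := gA' j.
have near_inv (B : set T) : nbhs (chart_inv i x) B ->
  \forall y \near x, B (chart_inv i y) by move=> /cinv.
have nU : nbhs (chart_inv i x) U by exact: open_nbhs_nbhs.
have nf : nbhs (chart_inv i x) (f @^-1` chart_dom j).
  by apply: (cf _ Ux); exact: open_nbhs_nbhs.
have nimg : nbhs x (chart_img i) by exact: open_nbhs_nbhs.
by apply: filterS3 nimg (near_inv _ nU) (near_inv _ nf) => y; split.
Qed.

(** Read in the chart [i] and in the charts [i1], [i2] of the factors, the map
    [(p1, p2)] is near [P] the splitting [(l1, l2)] of the model space. The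
    condition is local because a chart of a quotient need not be a product of
    charts of the factors. *)
Definition split_charts {V V1 V2 : normedModType R}
    {T T1 T2 : topologicalType} {A : atlas V T} {A1 : atlas V1 T1}
    {A2 : atlas V2 T2} (l1 : V -> V1) (l2 : V -> V2) (p1 : T -> T1)
    (p2 : T -> T2) (i : chart_index A) (P : T) (i1 : chart_index A1)
    (i2 : chart_index A2) : Prop :=
  [/\ chart_dom i1 (p1 P), chart_dom i2 (p2 P),
      \forall Q \near P, chart i1 (p1 Q) = l1 (chart i Q) &
      \forall Q \near P, chart i2 (p2 Q) = l2 (chart i Q)].

Section split_map.
Context {n1 n2 : nat} {V V1 V2 : normedModType R}.
Context {T T1 T2 T' T1' T2' : topologicalType}.
Context {A : atlas V T} {A1 : atlas V1 T1} {A2 : atlas V2 T2}.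
Context {A' : atlas (TR R (n1 + n2)) T'}.
Context {A1' : atlas (TR R n1) T1'} {A2' : atlas (TR R n2) T2'}.
Hypotheses (gA : good_atlas A) (gA1 : good_atlas A1) (gA2 : good_atlas A2).
Hypotheses (gA1' : good_atlas A1') (gA2' : good_atlas A2').
Context {l1 : V -> V1} {l2 : V -> V2}.
Hypotheses (l1P : linear l1 /\ continuous l1) (l2P : linear l2 /\ continuous l2).
Context {p1 : T -> T1} {p2 : T -> T2} {q1 : T' -> T1'} {q2 : T' -> T2'}.
Hypotheses (cp1 : continuous p1) (cp2 : continuous p2).
Context {U : set T} {U1 : set T1} {U2 : set T2}.
Hypotheses (oU : open U) (oU1 : open U1) (oU2 : open U2).
Hypotheses (UU1 : forall P, U P -> U1 (p1 P)) (UU2 : forall P, U P -> U2 (p2 P)).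
Context {f : T -> T'} {f1 : T1 -> T1'} {f2 : T2 -> T2'}.
Hypotheses (ff1 : forall P, U P -> q1 (f P) = f1 (p1 P)).
Hypotheses (ff2 : forall P, U P -> q2 (f P) = f2 (p2 P)).
Hypothesis cf : forall P, U P -> {for P, continuous f}.

(** Near [x], a point is recovered from its two components by the charts of
    the factors, and so is its image; [f] acts on each component separately.
    *)
Lemma coord_map_split i j x i1 i2 j1 j2 :
  coord_dom (A := A) (A' := A') U f i j x ->
  split_charts (A := A) (A1 := A1) (A2 := A2) l1 l2 p1 p2
    i (chart_inv i x) i1 i2 ->
  split_charts (A := A') (A1 := A1') (A2 := A2') TR_left TR_right q1 q2
    j (f (chart_inv i x)) j1 j2 ->
  [/\ coord_dom (A := A1) (A' := A1') U1 f1 i1 j1 (l1 x),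
      coord_dom (A := A2) (A' := A2') U2 f2 i2 j2 (l2 x),
      chart_inv i1 (l1 x) = p1 (chart_inv i x),
      chart_inv i2 (l2 x) = p2 (chart_inv i x) &
      \forall y \near x, coord_map (A := A) (A' := A') f i j y
        = TR_join (coord_map (A := A1) (A' := A1') f1 i1 j1 (l1 y))
                  (coord_map (A := A2) (A' := A2') f2 i2 j2 (l2 y))].
Proof.
move=> [ix Ux jx] [i1P i2P e1 e2] [j1P j2P e1' e2'].
have [_ oimg _ /(_ x ix)[cinv idx]] := gA i.
have [oi1 _ i1K _] := gA1 i1; have [oi2 _ i2K _] := gA2 i2.
have xE := chart_imgK gA ix.
have l1x : l1 x = chart i1 (p1 (chart_inv i x)).
  by rewrite (nbhs_singleton e1) xE.
have l2x : l2 x = chart i2 (p2 (chart_inv i x)).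
  by rewrite (nbhs_singleton e2) xE.
have inv1 : chart_inv i1 (l1 x) = p1 (chart_inv i x).
  by rewrite l1x; have [] := i1K _ i1P.
have inv2 : chart_inv i2 (l2 x) = p2 (chart_inv i x).
  by rewrite l2x; have [] := i2K _ i2P.
split => //.
- split; first by exists (p1 (chart_inv i x)).
    by rewrite inv1; exact: UU1.
  by rewrite inv1 -ff1.
- split; first by exists (p2 (chart_inv i x)).
    by rewrite inv2; exact: UU2.
  by rewrite inv2 -ff2.
have near_inv (B : set T) : nbhs (chart_inv i x) B ->
  \forall y \near x, B (chart_inv i y) by move=> /cinv.
have nf (B : set T') : nbhs (f (chart_inv i x)) B ->
    \forall y \near x, B (f (chart_inv i y)).
  by move=> nB; apply: (near_inv (f @^-1` B)); exact: (cf Ux).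
have nd1 : \forall y \near x, chart_dom i1 (p1 (chart_inv i y)).
  by apply: (near_inv (p1 @^-1` _)); apply: cp1; exact: open_nbhs_nbhs.
have nd2 : \forall y \near x, chart_dom i2 (p2 (chart_inv i y)).
  by apply: (near_inv (p2 @^-1` _)); apply: cp2; exact: open_nbhs_nbhs.
have nU : \forall y \near x, U (chart_inv i y).
  by apply: near_inv; exact: open_nbhs_nbhs.
have nimg : nbhs x (chart_img i) by exact: open_nbhs_nbhs.
near=> y; rewrite /coord_map.
have iy : chart_img i y by near: y.
have Uy : U (chart_inv i y) by near: y.
have E1 : chart i1 (p1 (chart_inv i y)) = l1 y.
  by rewrite -[in RHS](chart_imgK gA iy); near: y; exact: (near_inv _ e1).
have E2 : chart i2 (p2 (chart_inv i y)) = l2 y.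
  by rewrite -[in RHS](chart_imgK gA iy); near: y; exact: (near_inv _ e2).
have [|_ K1] := i1K (p1 (chart_inv i y)); first by near: y.
have [|_ K2] := i2K (p2 (chart_inv i y)); first by near: y.
rewrite -E1 -E2 K1 K2 -ff1// -ff2// -[LHS]TR_joinK; congr TR_join; apply/esym.
  by near: y; exact: (nf _ e1').
by near: y; exact: (nf _ e2').
Unshelve. all: by end_near. Qed.

Hypothesis split_source : forall i P, chart_dom i P ->
  exists i1 i2, split_charts (A := A) (A1 := A1) (A2 := A2) l1 l2 p1 p2 i P i1 i2.
Hypothesis split_target : forall i P, chart_dom i P ->
  exists i1 i2, split_charts (A := A') (A1 := A1') (A2 := A2')
    TR_left TR_right q1 q2 i P i1 i2.
Hypotheses (s1 : smooth_on A1 A1' U1 f1) (s2 : smooth_on A2 A2' U2 f2).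

Lemma smooth_on_split : smooth_on A A' U f.
Proof.
split => // i j; apply: smooth_local => x dx; have [ix Ux jx] := dx.
have [_ _ _ /(_ x ix)[_ idx]] := gA i.
have [i1 [i2 sP]] := split_source idx; have [j1 [j2 sfP]] := split_target jx.
have [d1 d2 _ _ E] := coord_map_split dx sP sfP.
have [c1 /(_ i1 j1) S1] := s1; have [c2 /(_ i2 j2) S2] := s2.
have o1 := @coord_dom_open _ _ _ _ _ _ U1 f1 i1 j1 gA1 gA1' oU1 c1.
have o2 := @coord_dom_open _ _ _ _ _ _ U2 f2 i2 j2 gA2 gA2' oU2 c2.
have Sj := smooth_join l1P l2P o1 o2 S1 S2.
move: E; rewrite /prop_near1 nbhsE => -[B [oB Bx] BE].
set D := (X in smooth X _) in Sj.
have oD : open D.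
  apply: openI; first by have [_ /continuousP] := l1P; exact.
  by have [_ /continuousP] := l2P; exact.
exists (B `&` D); first by split=> //; split.
apply: (smooth_eq (openI oB oD)) (smooth_sub (@subIsetr _ _ _) Sj) => y [By _].
exact/esym/BE.
Qed.

Lemma diff_coord_map_split i j x i1 i2 j1 j2 :
  coord_dom (A := A) (A' := A') U f i j x ->
  split_charts (A := A) (A1 := A1) (A2 := A2) l1 l2 p1 p2
    i (chart_inv i x) i1 i2 ->
  split_charts (A := A') (A1 := A1') (A2 := A2') TR_left TR_right q1 q2
    j (f (chart_inv i x)) j1 j2 ->
  forall a, 'd (coord_map (A := A) (A' := A') f i j) x a
    = TR_join ('d (coord_map (A := A1) (A' := A1') f1 i1 j1) (l1 x) (l1 a))
              ('d (coord_map (A := A2) (A' := A2') f2 i2 j2) (l2 x) (l2 a)).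
Proof.
move=> dx sP sfP a; have [d1 d2 _ _ E] := coord_map_split dx sP sfP.
have [_ /(_ i1 j1) S1] := s1; have [_ /(_ i2 j2) S2] := s2.
have D1 := smooth_diff S1 d1; have D2 := smooth_diff S2 d2.
have [D DE] := diff_join l1P l2P D1 D2.
have E' : {near x, (fun y =>
    TR_join (coord_map (A := A1) (A' := A1') f1 i1 j1 (l1 y))
            (coord_map (A := A2) (A' := A2') f2 i2 j2 (l2 y)))
  =1 coord_map (A := A) (A' := A') f i j}.
  by apply: filterS E => y ->.
have [_ dE] := near_eq_diff E' D.
exact: (etrans (congr1 (fun h : V -> TR R (n1 + n2) => h a) dE) (DE a)).
Qed.

End split_map.
End atlases.

(** * Kaehler manifolds that split *)

Lemma pair_continuous_at {T A B : topologicalType} (f : T -> A) (g : T -> B) x :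
  {for x, continuous f} -> {for x, continuous g} ->
  {for x, continuous (fun y => (f y, g y))}.
Proof. by move=> cf cg; apply: cvg_pair; [exact: cf|exact: cg]. Qed.

Lemma comp_continuous_at {T A B : topologicalType} (f : T -> A) (g : A -> B) x :
  {for x, continuous f} -> {for f x, continuous g} ->
  {for x, continuous (fun y => g (f y))}.
Proof. exact: continuous_comp. Qed.

Section topology_product.
Context {T1 T2 : topologicalType}.

Lemma open_setX (A : set T1) (B : set T2) : open A -> open B -> open (A `*` B).
Proof.
move=> oA oB; rewrite (_ : A `*` B = fst @^-1` A `&` snd @^-1` B)//.
apply: openI.
  by have /continuousP := @fst_continuous T1 T2; exact.
by have /continuousP := @snd_continuous T1 T2; exact.
Qed.

(** A non-empty clopen set meets a slice in a clopen set, so it contains every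
    horizontal and every vertical slice that it meets. *)
Lemma connected_setT_prod :
  connected [set: T1] -> connected [set: T2] -> connected [set: T1 * T2].
Proof.
move=> c1 c2 B [[x0 y0] Bxy] [C oC BC] [D cD BD].
have {}BC : B = C by rewrite BC setTI.
have {}BD : B = D by rewrite BD setTI.
have B1 y : (exists x, B (x, y)) -> [set x | B (x, y)] = setT.
  move=> [x Bx]; have cy : continuous (fun x : T1 => (x, y)).
    by apply: pair_continuous => z; [exact: cvg_id|exact: cvg_cst].
  apply: c1; first by exists x.
    exists [set x | B (x, y)]; last by rewrite setTI.
    by rewrite BC; move/continuousP: cy; exact.
  exists [set x | B (x, y)]; last by rewrite setTI.
  by rewrite BD; move/continuous_closedP: cy; exact.
have B2 x : (exists y, B (x, y)) -> [set y | B (x, y)] = setT.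
  move=> [y By]; have cx : continuous (fun y : T2 => (x, y)).
    by apply: pair_continuous => z; [exact: cvg_cst|exact: cvg_id].
  apply: c2; first by exists y.
    exists [set y | B (x, y)]; last by rewrite setTI.
    by rewrite BC; move/continuousP: cx; exact.
  exists [set y | B (x, y)]; last by rewrite setTI.
  by rewrite BD; move/continuous_closedP: cx; exact.
apply/seteqP; split => // -[x y] _.
have Bx : B (x, y0).
  by have := B1 y0 (ex_intro _ x0 Bxy); move/seteqP => [_ /(_ x I)].
by have := B2 x (ex_intro _ y0 Bx); move/seteqP => [_ /(_ y I)].
Qed.

Lemma hausdorff_prod : hausdorff_space T1 -> hausdorff_space T2 ->
  hausdorff_space (T1 * T2)%type.
Proof.
move=> h1 h2 [x y] [x' y'] cl; congr (_, _).
  apply: h1 => A B Ax Bx'.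
  have [|| [z w] [Az Bz]] := cl (fst @^-1` A) (fst @^-1` B).
  - exact: (@fst_continuous _ _ (x, y) _ Ax).
  - exact: (@fst_continuous _ _ (x', y') _ Bx').
  by exists z.
apply: h2 => A B Ay By'.
have [|| [z w] [Aw Bw]] := cl (snd @^-1` A) (snd @^-1` B).
- exact: (@snd_continuous _ _ (x, y) _ Ay).
- exact: (@snd_continuous _ _ (x', y') _ By').
by exists w.
Qed.

Lemma second_countable_prod : @second_countable T1 -> @second_countable T2 ->
  @second_countable (T1 * T2)%type.
Proof.
move=> [B1 c1 [sub1 b1]] [B2 c2 [sub2 b2]].
exists ((fun p => p.1 `*` p.2) @` (B1 `*` B2)).
  apply: sub_countable (card_image_le _ _) _; exact: countableX.
split.
  by move=> _ [[A B] [bA bB] <-]; exact: open_setX (sub1 _ bA) (sub2 _ bB).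
move=> [x y] W [[P Q] [/= Px Qy] PQW].
have [A [BA Ax] AP] := b1 x P Px; have [B [BB By] BQ] := b2 y Q Qy.
exists (A `*` B); first by split=> //; exists (A, B).
by move=> [z w] [Az Bw]; apply: PQW; split; [exact: AP|exact: BQ].
Qed.

End topology_product.

Lemma diff_add_comp {R : realType} {V V1 V2 W : normedModType R}
    (l1 : V -> V1) (l2 : V -> V2) (f1 : V1 -> W) (f2 : V2 -> W) x a :
  linear l1 /\ continuous l1 -> linear l2 /\ continuous l2 ->
  differentiable f1 (l1 x) -> differentiable f2 (l2 x) ->
  'd (fun y => f1 (l1 y) + f2 (l2 y)) x a
    = 'd f1 (l1 x) (l1 a) + 'd f2 (l2 x) (l2 a).
Proof.
move=> [ll1 cl1] [ll2 cl2] d1 d2; have [lid cid] := @id_clinear R W.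
have [e1 E1] := diff_linear_comp ll1 cl1 lid cid d1.
have [e2 E2] := diff_linear_comp ll2 cl2 lid cid d2.
by apply: (etrans (diff_addE a e1 e2)); exact: (congr2 +%R (E1 a) (E2 a)).
Qed.

Lemma smooth_add_comp {R : realType} {V V1 V2 W : normedModType R}
    (l1 : V -> V1) (l2 : V -> V2) U1 U2 (f1 : V1 -> W) (f2 : V2 -> W) :
  linear l1 /\ continuous l1 -> linear l2 /\ continuous l2 ->
  open U1 -> open U2 -> smooth U1 f1 -> smooth U2 f2 ->
  smooth (l1 @^-1` U1 `&` l2 @^-1` U2) (fun y => f1 (l1 y) + f2 (l2 y)).
Proof.
move=> [ll1 cl1] [ll2 cl2] oU1 oU2 s1 s2; have [lid cid] := @id_clinear R W.
have o1 : open (l1 @^-1` U1) by move/continuousP: cl1; exact.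
have o2 : open (l2 @^-1` U2) by move/continuousP: cl2; exact.
apply: smoothD; first exact: openI.
  apply: smooth_sub (@subIsetl _ _ _) _.
  exact: (smooth_linear_comp ll1 cl1 lid cid oU1 s1).
apply: smooth_sub (@subIsetr _ _ _) _.
exact: (smooth_linear_comp ll2 cl2 lid cid oU2 s2).
Qed.

Lemma manifold_good_atlas {R : realType} {V : normedModType R}
  {T : topologicalType} (A : atlas V T) : is_manifold A -> good_atlas A.
Proof. by case. Qed.

Section kahler_split.
Context {R : realType} {n1 n2 : nat}.

(** [(p1, p2)] is a local isometry of [N] to the Riemannian product of [N1] and
    [N2] that induces the topology of [N]; the third condition makes
    componentwise continuity sufficient for maps to [N]. *)
Definition kahler_split (N : kahler_data R (n1 + n2)) (N1 : kahler_data R n1)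
    (N2 : kahler_data R n2) (p1 : N -> N1) (p2 : N -> N2) : Prop :=
  [/\ continuous p1, continuous p2,
      forall P W, nbhs P W -> exists W1 W2,
        [/\ nbhs (p1 P) W1, nbhs (p2 P) W2 &
            forall Q, W1 (p1 Q) -> W2 (p2 Q) -> W Q] &
      forall i P, chart_dom i P -> exists i1 i2,
        split_charts (A := katlas N) (A1 := katlas N1) (A2 := katlas N2)
          TR_left TR_right p1 p2 i P i1 i2 /\
        forall a b, kmetric i P a b
          = kmetric i1 (p1 P) (TR_left a) (TR_left b)
            + kmetric i2 (p2 P) (TR_right a) (TR_right b)].

Lemma kahler_prod_split (N1 : kahler_data R n1) (N2 : kahler_data R n2) :
  kahler_split (N := kahler_prod N1 N2) fst snd.
Proof.
split; [exact: fst_continuous|exact: snd_continuous| |].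
- move=> P W [[A B] [/= AP BP] ABW]; exists A, B; split=> // Q AQ BQ.
  exact: ABW.
- move=> [i1 i2] P [/= d1 d2]; exists i1, i2; split=> //.
  split; [exact: d1|exact: d2| |]; apply: (@filterE _ (nbhs P)) => Q.
    by rewrite /= TR_joinKl.
  by rewrite /= TR_joinKr.
Qed.

Lemma kahler_prod_good_atlas (N1 : kahler_data R n1) (N2 : kahler_data R n2) :
  good_atlas (katlas N1) -> good_atlas (katlas N2) ->
  good_atlas (katlas (kahler_prod N1 N2)).
Proof.
move=> g1 g2 [i1 i2].
have [dom_o1 oi1 k1 k1'] := g1 i1; have [dom_o2 oi2 k2 k2'] := g2 i2.
have imgE : chart_img (A := katlas (kahler_prod N1 N2)) (i1, i2)
    = TR_left @^-1` chart_img i1 `&` TR_right @^-1` chart_img i2.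
  apply/seteqP; split => [_ [[P Q] [/= dP dQ] <-]|x [[P dP e1] [Q dQ e2]]].
    by split; rewrite /= ?TR_joinKl ?TR_joinKr; [exists P|exists Q].
  by exists (P, Q) => //=; rewrite e1 e2 TR_joinK.
split.
- exact: open_setX dom_o1 dom_o2.
- rewrite imgE; apply: openI.
    by have [_ /continuousP] := @TR_left_clinear R n1 n2; exact.
  by have [_ /continuousP] := @TR_right_clinear R n1 n2; exact.
- move=> [P Q] [/= dP dQ]; have [c1 e1] := k1 _ dP; have [c2 e2] := k2 _ dQ.
  split; last by rewrite /= TR_joinKl TR_joinKr e1 e2.
  have k1c := comp_continuous_at (@fst_continuous N1 N2 (P, Q)) c1.
  have k2c := comp_continuous_at (@snd_continuous N1 N2 (P, Q)) c2.
  exact: (comp_continuous_at (pair_continuous_at k1c k2c)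
    (@TR_join_continuous R n1 n2 (chart i1 P, chart i2 Q))).
- rewrite imgE => x [d1 d2]; have [c1 e1] := k1' _ d1; have [c2 e2] := k2' _ d2.
  split; last by split.
  have k1c := comp_continuous_at ((@TR_left_clinear R n1 n2).2 x) c1.
  have k2c := comp_continuous_at ((@TR_right_clinear R n1 n2).2 x) c2.
  exact: (pair_continuous_at k1c k2c).
Qed.

Section split_morphism.
Context {N N' : kahler_data R (n1 + n2)}.
Context {N1 N1' : kahler_data R n1} {N2 N2' : kahler_data R n2}.
Context {p1 : N -> N1} {p2 : N -> N2} {q1 : N' -> N1'} {q2 : N' -> N2'}.
Hypotheses (sN : kahler_split p1 p2) (sN' : kahler_split q1 q2).
Hypotheses (g : good_atlas (katlas N)) (g1 : good_atlas (katlas N1)).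
Hypotheses (g2 : good_atlas (katlas N2)) (g1' : good_atlas (katlas N1')).
Hypotheses (g2' : good_atlas (katlas N2')).

Section on_open.
Context {U : set N} {U1 : set N1} {U2 : set N2}.
Hypotheses (oU : open U) (oU1 : open U1) (oU2 : open U2).
Hypotheses (UU1 : forall P, U P -> U1 (p1 P)) (UU2 : forall P, U P -> U2 (p2 P)).
Context {f : N -> N'} {f1 : N1 -> N1'} {f2 : N2 -> N2'}.
Hypotheses (ff1 : forall P, U P -> q1 (f P) = f1 (p1 P)).
Hypotheses (ff2 : forall P, U P -> q2 (f P) = f2 (p2 P)).

Lemma split_continuous P : U P -> {for p1 P, continuous f1} ->
  {for p2 P, continuous f2} -> {for P, continuous f}.
Proof.
have [cp1 cp2 _ _] := sN; have [_ _ ind _] := sN'.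
move=> UP c1 c2 W /ind [W1 [W2 [nW1 nW2 WW]]].
rewrite ff1// in nW1; rewrite ff2// in nW2.
have nU : nbhs P U by exact: open_nbhs_nbhs.
apply: filterS3 nU (cp1 _ _ (c1 _ nW1)) (cp2 _ _ (c2 _ nW2)) => Q UQ A B.
by apply: WW; rewrite ?ff1 ?ff2.
Qed.

Lemma split_smooth_on : smooth_on (katlas N1) (katlas N1') U1 f1 ->
  smooth_on (katlas N2) (katlas N2') U2 f2 ->
  smooth_on (katlas N) (katlas N') U f.
Proof.
move=> s1 s2; have [cp1 cp2 _ spl] := sN; have [_ _ _ spl'] := sN'.
apply: (smooth_on_split g g1 g2 g1' g2' TR_left_clinear TR_right_clinear cp1 cp2
  oU oU1 oU2 UU1 UU2 ff1 ff2 _ _ _ s1 s2).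
- move=> P UP; apply: split_continuous => //.
    by have [c1 _] := s1; exact/c1/UU1.
  by have [c2 _] := s2; exact/c2/UU2.
- by move=> i P /spl [i1 [i2 [? _]]]; exists i1, i2.
- by move=> i P /spl' [i1 [i2 [? _]]]; exists i1, i2.
Qed.

End on_open.

Context {f : N -> N'} {f1 : N1 -> N1'} {f2 : N2 -> N2'}.
Hypotheses (ff1 : forall P, q1 (f P) = f1 (p1 P)).
Hypotheses (ff2 : forall P, q2 (f P) = f2 (p2 P)).
Hypotheses (h1 : holomorphic f1) (h2 : holomorphic f2).

Let smooth_f : smooth_on (katlas N) (katlas N') setT f.
Proof.
have [s1 _] := h1; have [s2 _] := h2.
by apply: (split_smooth_on openT openT openT _ _ _ _ s1 s2).
Qed.

(** What holomorphy and isometry say about [f] at a point of a chart, expressed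
    by its components in charts that split there. *)
Lemma split_coord i j x :
  coord_dom (A := katlas N) (A' := katlas N') setT f i j x ->
  exists i1 i2 j1 j2,
  [/\ coord_dom (A := katlas N1) (A' := katlas N1') setT f1 i1 j1 (TR_left x),
      coord_dom (A := katlas N2) (A' := katlas N2') setT f2 i2 j2 (TR_right x),
      forall a, 'd (coord_map (A := katlas N) (A' := katlas N') f i j) x a
        = TR_join
           ('d (coord_map (A := katlas N1) (A' := katlas N1') f1 i1 j1)
               (TR_left x) (TR_left a))
           ('d (coord_map (A := katlas N2) (A' := katlas N2') f2 i2 j2)
               (TR_right x) (TR_right a)),
      forall a b, kmetric i (chart_inv i x) a b
        = kmetric i1 (chart_inv i1 (TR_left x)) (TR_left a) (TR_left b)
          + kmetric i2 (chart_inv i2 (TR_right x)) (TR_right a) (TR_right b) &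
      forall a b, kmetric j (f (chart_inv i x)) a b
        = kmetric j1 (f1 (chart_inv i1 (TR_left x))) (TR_left a) (TR_left b)
          + kmetric j2 (f2 (chart_inv i2 (TR_right x))) (TR_right a) (TR_right b)].
Proof.
move=> dx; have [ix _ jx] := dx.
have [s1 _] := h1; have [s2 _] := h2; have [c1 _] := s1; have [c2 _] := s2.
have [cp1 cp2 _ spl] := sN; have [_ _ _ spl'] := sN'.
have [_ _ _ /(_ x ix)[_ idx]] := g i.
have [i1 [i2 [sP mP]]] := spl _ _ idx; have [j1 [j2 [sfP mfP]]] := spl' _ _ jx.
have UU1 (P : N) : [set: N] P -> [set: N1] (p1 P) by [].
have UU2 (P : N) : [set: N] P -> [set: N2] (p2 P) by [].
have ff1' (P : N) : [set: N] P -> q1 (f P) = f1 (p1 P) by move=> _.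
have ff2' (P : N) : [set: N] P -> q2 (f P) = f2 (p2 P) by move=> _.
have cf : forall P, [set: N] P -> {for P, continuous f} by have [] := smooth_f.
have [d1 d2 v1 v2 _] := coord_map_split g g1 g2 cp1 cp2 openT UU1 UU2
  ff1' ff2' cf dx sP sfP.
exists i1, i2, j1, j2; split => //.
- exact: (diff_coord_map_split g g1 g2 TR_left_clinear TR_right_clinear cp1 cp2
    openT UU1 UU2 ff1' ff2' cf s1 s2 dx sP sfP).
- by move=> a b; rewrite mP v1 v2.
- by move=> a b; rewrite mfP ff1 ff2 v1 v2.
Qed.

Lemma split_holomorphic : holomorphic f.
Proof.
split=> // i j x a /split_coord [i1 [i2 [j1 [j2 [d1 d2 E _ _]]]]].
have [_ H1] := h1; have [_ H2] := h2.
apply: (etrans (E (cplxJ a))); apply: (etrans _ (esym (congr1 cplxJ (E a)))).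
rewrite TR_join_J TR_left_J TR_right_J.
by congr TR_join; [exact: H1|exact: H2].
Qed.

Lemma split_isometric : isometric f1 -> isometric f2 -> isometric f.
Proof.
move=> m1 m2 i j x a b /split_coord [i1 [i2 [j1 [j2 [d1 d2 E M M']]]]].
rewrite M M'.
rewrite (congr1 TR_left (E a)) (congr1 TR_left (E b)).
rewrite (congr1 TR_right (E a)) (congr1 TR_right (E b)).
by rewrite !TR_joinKl !TR_joinKr; congr (_ + _); [exact: m1|exact: m2].
Qed.

End split_morphism.

(** Compatibility of the charts and of the local expressions of the metric
    says that the identity is holomorphic and isometric, and the identity acts
    on each component separately. The closedness of the Kaehler form is the
    sum of the conditions on the factors, as each summand depends on the
    coordinates of one factor. *)
Lemma kahler_prod_kahler (N1 : kahler_data R n1) (N2 : kahler_data R n2) :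
  is_kahler N1 -> is_kahler N2 -> is_kahler (kahler_prod N1 N2).
Proof.
move=> [M1 H1 I1 A1 D1] [M2 H2 I2 A2 D2].
have g1 := manifold_good_atlas M1; have g2 := manifold_good_atlas M2.
have g := kahler_prod_good_atlas g1 g2.
have sp := kahler_prod_split N1 N2.
have Hid : holomorphic (N := kahler_prod N1 N2) (N' := kahler_prod N1 N2) id.
  exact: (split_holomorphic sp sp g g1 g2 g1 g2 (f := id) (f1 := id) (f2 := id)).
split => //.
- have [T1 S1 C1 _ _] := M1; have [T2 S2 C2 _ _] := M2; have [Sid _] := Hid.
  split => //; [exact: hausdorff_prod|exact: second_countable_prod|].
  move=> [P Q]; have [i iP] := C1 P; have [j jQ] := C2 Q.
  by exists (i, j); split.
- exact: (split_isometric sp sp g g1 g2 g1 g2 (f := id) (f1 := id) (f2 := id)).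
- move=> [i1 i2] [P Q] [/= dP dQ].
  have [lin1 sym1 pos1 J1] := A1 _ _ dP; have [lin2 sym2 pos2 J2] := A2 _ _ dQ.
  have ge1 a : 0 <= kmetric i1 P a a.
    have [->|/pos1/ltW//] := eqVneq a 0.
    have := lin1 1 0 0 0; rewrite scale1r add0r mul1r => /eqP.
    by rewrite -subr_eq subrr eq_sym => /eqP ->.
  have ge2 a : 0 <= kmetric i2 Q a a.
    have [->|/pos2/ltW//] := eqVneq a 0.
    have := lin2 1 0 0 0; rewrite scale1r add0r mul1r => /eqP.
    by rewrite -subr_eq subrr eq_sym => /eqP ->.
  split => /=.
  + move=> c a a' b; rewrite (@TR_left_clinear R n1 n2).1.
    by rewrite (@TR_right_clinear R n1 n2).1 lin1 lin2 mulrDr addrACA.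
  + by move=> a b; rewrite sym1 sym2.
  + move=> a a0; have [l0|l0] := eqVneq (TR_left a) 0; last first.
      by apply: ltr_wpDr; [exact: ge2|exact: pos1].
    apply: ltr_wpDl; first exact: ge1.
    apply: pos2; apply: contra_neq a0 => r0.
    rewrite -(TR_joinK a) l0 r0; apply: injective_projections => /=;
    by rewrite row_mx0.
  + by move=> a b; rewrite !TR_left_J !TR_right_J J1 J2.
- move=> [i1 i2]; have [S1 B1] := D1 i1; have [S2 B2] := D2 i2.
  have [_ oi1 _ _] := g1 i1; have [_ oi2 _ _] := g2 i2.
  have imgS : chart_img (A := katlas (kahler_prod N1 N2)) (i1, i2)
    `<=` TR_left @^-1` chart_img i1 `&` TR_right @^-1` chart_img i2.
    move=> _ [[P Q] [/= dP dQ] <-].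
    by split; rewrite /= ?TR_joinKl ?TR_joinKr; [exists P|exists Q].
  split.
    move=> a b; apply: smooth_sub imgS _ => /=.
    exact: (smooth_add_comp TR_left_clinear TR_right_clinear oi1 oi2
      (S1 (TR_left a) (TR_left b)) (S2 (TR_right a) (TR_right b))).
  move=> x a b c /imgS [x1 x2].
  have E u v w : 'd (fun y => kform (N := kahler_prod N1 N2) (i1, i2)
      (chart_inv (a := katlas (kahler_prod N1 N2)) (i1, i2) y) v w) x u
    = 'd (fun y => kform i1 (chart_inv i1 y) (TR_left v) (TR_left w))
        (TR_left x) (TR_left u)
    + 'd (fun y => kform i2 (chart_inv i2 y) (TR_right v) (TR_right w))
        (TR_right x) (TR_right u).
    have kE : (fun y => kform (N := kahler_prod N1 N2) (i1, i2)
        (chart_inv (a := katlas (kahler_prod N1 N2)) (i1, i2) y) v w)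
      = (fun y => kform i1 (chart_inv i1 (TR_left y)) (TR_left v) (TR_left w)
                + kform i2 (chart_inv i2 (TR_right y)) (TR_right v) (TR_right w)).
      by apply/funext => y; rewrite /kform /= TR_left_J TR_right_J.
    apply: (etrans (congr1 (fun h : TR R (n1 + n2) -> R => 'd h x u) kE)).
    have Ed1 := smooth_diff (S1 (cplxJ (TR_left v)) (TR_left w)) x1.
    have Ed2 := smooth_diff (S2 (cplxJ (TR_right v)) (TR_right w)) x2.
    exact: (diff_add_comp u TR_left_clinear TR_right_clinear Ed1 Ed2).
  have alg (y1 y2 z1 z2 w1 w2 : R) : y1 + z1 + w1 = 0 -> y2 + z2 + w2 = 0 ->
    (y1 + y2) + (z1 + z2) + (w1 + w2) = 0 by lra.
  apply: (etrans (congr2 +%R (congr2 +%R (E a b c) (E b c a)) (E c a b))).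
  by apply: alg; [exact: B1|exact: B2].
Qed.

End kahler_split.

(** * Quotients by discrete groups of translations *)

Section covering_quotient.
Context {R : realType} {V : normedModType R}.

(** The conditions under which the local sections of the projection are the
    charts of an atlas. *)
Definition covering_quot (Q : quotType V) : Prop :=
  (forall D : set V, open D -> open (\pi_Q @^-1` (\pi_Q @` D))) /\
  (forall x : V, exists U, [/\ open U, U x &
    forall y z, U y -> U z -> \pi_Q y = \pi_Q z -> y = z]).

Context {Q : quotType V}.

Lemma section_open (s : local_section Q) : open (section_dom s).
Proof. by case: s. Qed.

Lemma section_mapK (s : local_section Q) x :
  section_dom s x -> section_map s (\pi_Q x) = x.
Proof. by case: s => D m oD mK; apply: mK. Qed.

(** The projections to [Q] and to its topological copy are equal, but not
    convertible. *)
Lemma pi_quotient_topology :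
  (\pi_(quotient_topology Q) : V -> Q) = \pi_Q :> (V -> Q).
Proof. by rewrite !pi.unlock. Qed.

Lemma pi_cts : continuous (\pi_Q : V -> quotient_topology Q).
Proof. by rewrite -pi_quotient_topology; exact: pi_continuous. Qed.

Lemma open_quotE (D : set (quotient_topology Q)) :
  open (\pi_Q @^-1` D) -> open D.
Proof. by rewrite /open /= /quotient_open pi_quotient_topology. Qed.

Hypothesis cQ : covering_quot Q.

Lemma pi_open (D : set V) : open D ->
  open (\pi_Q @` D : set (quotient_topology Q)).
Proof. by move=> oD; apply: open_quotE; have [H _] := cQ; exact: H. Qed.

Lemma quot_good_atlas : good_atlas (quotient_atlas Q).
Proof.
move=> s; have oD := section_open s; have sK := @section_mapK s.
have imgE : chart_img (A := quotient_atlas Q) s = section_dom s.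
  apply/seteqP; split => [_ [_ [x Dx <-] <-]|x Dx] /=; first by rewrite sK.
  by exists (\pi_Q x); [exists x|rewrite /= sK].
split.
- exact: pi_open.
- by rewrite imgE.
- move=> _ [x Dx <-]; rewrite /= sK//; split => // W nW.
  have nWD : nbhs x (W `&` section_dom s).
    by apply: filterI; [move: nW; rewrite /= sK|exact: open_nbhs_nbhs].
  rewrite nbhsE; exists (\pi_Q @` (interior (W `&` section_dom s))).
    split; first by apply: pi_open; exact: open_interior.
    by exists x.
  by move=> _ [y /interior_subset [Wy Dy] <-]; rewrite /= sK.
- rewrite imgE => x Dx; split; last by exists x.
  exact: pi_cts.
Qed.

Lemma local_section_at (x : V) : exists s : local_section Q, section_dom s x.
Proof.
have [_ /(_ x)[U [oU Ux injU]]] := cQ.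
pose lift q := xget x [set z | U z /\ \pi_Q z = q].
have liftK y : U y -> lift (\pi_Q y) = y.
  move=> Uy; have [|Uz Ez] := @xgetPex _ x [set z | U z /\ \pi_Q z = \pi_Q y].
    by exists y.
  exact: injU.
by exists (@LocalSection R V Q U lift oU liftK).
Qed.

End covering_quotient.

Section quotient_split.
Context {R : realType} {V V1 V2 : normedModType R}.
Context {Q : quotType V} {Q1 : quotType V1} {Q2 : quotType V2}.
Hypotheses (cQ : covering_quot Q) (cQ1 : covering_quot Q1) (cQ2 : covering_quot Q2).
Context {l1 : V -> V1} {l2 : V -> V2} {jn : V1 -> V2 -> V}.
Hypotheses (cl1 : continuous l1) (cl2 : continuous l2).
Hypothesis cjn : continuous (fun p : V1 * V2 => jn p.1 p.2).
Hypotheses (jn1 : forall a b, l1 (jn a b) = a) (jn2 : forall a b, l2 (jn a b) = b).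
Hypothesis jnK : forall x, jn (l1 x) (l2 x) = x.
Hypothesis compat : forall x y, \pi_Q x = \pi_Q y <->
  \pi_Q1 (l1 x) = \pi_Q1 (l1 y) /\ \pi_Q2 (l2 x) = \pi_Q2 (l2 y).

Local Notation QT := (quotient_topology Q).
Local Notation QT1 := (quotient_topology Q1).
Local Notation QT2 := (quotient_topology Q2).

Definition quot_proj {W : Type} {Q' : quotType W} (l : V -> W)
  (P : quotient_topology Q) : quotient_topology Q' :=
  \pi_Q' (l (repr (P : Q))).

Local Notation p1 := (quot_proj (Q' := Q1) l1).
Local Notation p2 := (quot_proj (Q' := Q2) l2).

Lemma quot_proj1 x : p1 (\pi_Q x) = \pi_Q1 (l1 x).
Proof. by have /compat[] : \pi_Q (repr (\pi_Q x)) = \pi_Q x by rewrite reprK. Qed.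

Lemma quot_proj2 x : p2 (\pi_Q x) = \pi_Q2 (l2 x).
Proof. by have /compat[] : \pi_Q (repr (\pi_Q x)) = \pi_Q x by rewrite reprK. Qed.

Lemma quot_proj_inj P P' : p1 P = p1 P' -> p2 P = p2 P' -> P = P'.
Proof.
move=> e1 e2; rewrite -[P](reprK (P : Q)) -[P'](reprK (P' : Q)).
exact/compat.
Qed.

Lemma quot_proj1_continuous : continuous p1.
Proof.
apply/quotient_continuous; rewrite pi_quotient_topology.
rewrite (_ : _ \o _ = \pi_Q1 \o l1); last by apply/funext => x; exact: quot_proj1.
by move=> x; apply: continuous_comp; [exact: cl1|exact: pi_cts].
Qed.

Lemma quot_proj2_continuous : continuous p2.
Proof.
apply/quotient_continuous; rewrite pi_quotient_topology.
rewrite (_ : _ \o _ = \pi_Q2 \o l2); last by apply/funext => x; exact: quot_proj2.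
by move=> x; apply: continuous_comp; [exact: cl2|exact: pi_cts].
Qed.

(** The projections to the factors are open, so that the images of a product
    neighbourhood upstairs are neighbourhoods downstairs. *)
Lemma quot_proj_nbhs (P : QT) (W : set QT) : nbhs P W ->
  exists W1 W2, [/\ nbhs (p1 P) W1, nbhs (p2 P) W2 &
    forall P', W1 (p1 P') -> W2 (p2 P') -> W P'].
Proof.
rewrite -[P](reprK (P : Q)); set u := repr _ => nW.
have nWu : nbhs (jn (l1 u) (l2 u)) (\pi_Q @^-1` W).
  by rewrite jnK; exact: (@pi_cts _ _ Q u).
have [[B1 B2] [/= n1 n2] BW] := cjn (x := (l1 u, l2 u)) nWu.
have nB (V' : normedModType R) (Q' : quotType V') (cQ' : covering_quot Q') v
    (B : set V') : nbhs v B ->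
    nbhs (\pi_Q' v : quotient_topology Q') (\pi_Q' @` (interior B)).
  move=> nvB; apply: open_nbhs_nbhs; split; last by exists v.
  by apply: pi_open => //; exact: open_interior.
exists (\pi_Q1 @` (interior B1)), (\pi_Q2 @` (interior B2)).
rewrite quot_proj1 quot_proj2; split; [exact: nB|exact: nB|].
move=> P'; rewrite -[P'](reprK (P' : Q)); set v := repr _.
rewrite quot_proj1 quot_proj2.
move=> [b1 /interior_subset Bb1 e1] [b2 /interior_subset Bb2 e2].
have -> : \pi_Q v = \pi_Q (jn b1 b2) by apply/compat; rewrite jn1 jn2.
exact: (BW (b1, b2)).
Qed.

(** Local sections through the same lift of a point agree near it, so a local
    section of the product is near each point the join of local sections of
    the factors. *)
Lemma quot_split_charts (s : local_section Q) P :
  chart_dom (a := quotient_atlas Q) s P ->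
  exists s1 s2, split_charts (A := quotient_atlas Q) (A1 := quotient_atlas Q1)
    (A2 := quotient_atlas Q2) l1 l2 p1 p2 s P s1 s2.
Proof.
move=> [u Du <-].
have [s1 D1] := local_section_at cQ1 (l1 u).
have [s2 D2] := local_section_at cQ2 (l2 u).
have oD := section_open s; have sK := @section_mapK _ _ _ s.
have oD1 := section_open s1; have s1K := @section_mapK _ _ _ s1.
have oD2 := section_open s2; have s2K := @section_mapK _ _ _ s2.
have nB (B : set V) : open B -> B u ->
    nbhs (\pi_Q u : QT) (\pi_Q @` (section_dom s `&` B)).
  move=> oB Bu; apply: open_nbhs_nbhs; split; last by exists u.
  by apply: pi_open => //; exact: openI.
exists s1, s2; split.
- by rewrite quot_proj1; exists (l1 u).
- by rewrite quot_proj2; exists (l2 u).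
- apply: filterS (nB (l1 @^-1` section_dom s1) _ D1).
    by move=> _ [y [Dy D1y] <-] /=; rewrite quot_proj1 s1K ?sK.
  by move/continuousP: cl1; exact.
- apply: filterS (nB (l2 @^-1` section_dom s2) _ D2).
    by move=> _ [y [Dy D2y] <-] /=; rewrite quot_proj2 s2K ?sK.
  by move/continuousP: cl2; exact.
Qed.

End quotient_split.

Section lattice_quotient.
Context {R : realType} {V : normedModType R} {n : nat}.

(** The saturation of an open set is a union of translates of it, and a ball of
    radius [e / 2] cannot contain two points that differ by a non-zero vector of
    a group whose non-zero vectors have norm at least [e]. *)
Lemma lattice_covering_quot (Q : quotType V) (Lam : ('I_n -> int) -> V) :
  (forall x y, \pi_Q x = \pi_Q y <-> exists k, y = x + Lam k) ->
  (exists2 e : R, 0 < e & forall k, `|Lam k| < e -> Lam k = 0) ->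
  covering_quot Q.
Proof.
move=> piE [e e0 He]; split.
  move=> D oD; rewrite (_ : _ @^-1` _
    = \bigcup_k ((fun y => y - Lam k) @^-1` D)); last first.
    apply/seteqP; split => [y [x Dx /piE[k ->]]|y [k _ Dy]].
      by exists k => //=; rewrite addrK.
    by exists (y - Lam k) => //; apply/piE; exists k; rewrite subrK.
  apply: bigcup_open => k _.
  have : continuous (fun y : V => y - Lam k).
    by move=> y; apply: cvgB; [exact: cvg_id|exact: cvg_cst].
  by move/continuousP; exact.
move=> x; exists (ball x (e / 2)); split.
- exact: ball_open.
- by apply: ballxx; rewrite divr_gt0.
move=> y z; rewrite -ball_normE /= => xy xz /piE[k zE].
have : `|Lam k| < e.
  have -> : Lam k = (x - y) - (x - z).
    by rewrite zE opprB [RHS]addrC addrA subrK addrAC subrr add0r.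
  by rewrite (le_lt_trans (ler_normB _ _))// (splitr e) ltrD.
by move=> /He k0; rewrite zE k0 addr0.
Qed.

End lattice_quotient.

Lemma norm_coord_le {R : realType} {m n} (A : 'M[R]_(m, n)) i j :
  `|A i j| <= `|A|.
Proof.
rewrite [leRHS]/Num.Def.normr/= mx_normrE.
exact: (le_bigmax _ (fun ij : 'I_m * 'I_n => `|A ij.1 ij.2|) (i, j)).
Qed.

Section integer_rows.
Context {R : realType} {n : nat}.

Definition int_row (k : 'I_n -> int) : 'rV[R]_n := \row_i (k i)%:~R.

Lemma int_row_discrete (k : 'I_n -> int) : `|int_row k| < 1 -> int_row k = 0.
Proof.
move=> k1; apply/rowP => i; rewrite !mxE.
have := le_lt_trans (norm_coord_le (int_row k) 0 i) k1.
rewrite mxE -intr_norm -[X in _ < X]/(1%:~R) ltr_int => k0.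
by have -> : k i = 0 by lia.
Qed.

Lemma torus_piE (s t : 'rV[R]_n) :
  \pi_(torus_quot R n) s = \pi_(torus_quot R n) t
  <-> exists k, t = s + int_row k.
Proof.
split; first by move/eqmodP => /= /asboolP.
by move=> H; apply/eqmodP; exact/asboolP.
Qed.

Lemma torus_covering_quot : covering_quot (torus_quot R n).
Proof.
apply: (lattice_covering_quot torus_piE); exists 1 => // k.
exact: int_row_discrete.
Qed.

End integer_rows.

(** * Parallel frames, Hessian metrics and quotients of a product *)

Section constant_frames.
Context {R : realType} {n : nat}.
Implicit Types (C : 'M[R]_n) (X : 'I_n -> vfield R n).

Definition cst_frame C : 'I_n -> vfield R n := fun i _ => row i C.

Lemma sum_cst_frame C (k : 'I_n -> int) p :
  \sum_i cst_frame C i p *~ k i = int_row k *m C.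
Proof.
by rewrite mulmx_sum_row; apply: eq_bigr => i _; rewrite mxE scaler_int.
Qed.

Lemma sum_cst_frameR C (t : 'rV[R]_n) p :
  \sum_i t 0 i *: cst_frame C i p = t *m C.
Proof. by rewrite mulmx_sum_row. Qed.

(** A parallel field has zero differential, hence is constant. *)
Lemma generator_cst_frame L X : is_generator nabla_flat L X ->
  exists2 C, C \in unitmx & X = cst_frame C.
Proof.
move=> [par un _]; exists (\matrix_i X i 0); first exact: un.
apply/funext => i; apply/funext => p; rewrite /cst_frame rowK.
have [sX dX] := par i; apply: diff0_cst => // x v.
exact: (dX (fun=> v) x (smooth_cst setT v)).
Qed.

Definition frame_lattice X : set (TR R n) :=
  [set u | exists k : 'I_n -> int, u.2 = \sum_i (X i u.1) *~ k i].

Lemma cst_frame_generator C : C \in unitmx ->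
  is_generator nabla_flat (frame_lattice (cst_frame C)) (cst_frame C).
Proof.
move=> uC; split => //.
  move=> i; split; first exact: smooth_cst.
  move=> Y p _; rewrite /nabla_flat.
  exact: (congr1 (fun h : 'rV[R]_n -> 'rV[R]_n => h (Y p)) (diff_cst (row i C) p)).
by move=> p; rewrite (_ : \matrix_i _ = C)//; apply/row_matrixP => i; rewrite rowK.
Qed.

Lemma ML_piE C (u v : TR R n) :
  \pi_(ML_quot (cst_frame C)) u = \pi_(ML_quot (cst_frame C)) v <->
  exists k, v = u + (0, int_row k *m C).
Proof.
split=> [/eqmodP/= /asboolP[k ->]|[k ->]].
  exists k; rewrite /lattice_shift sum_cst_frame.
  by apply: injective_projections; rewrite /= ?addr0.
apply/eqmodP; apply/asboolP; exists k; rewrite /lattice_shift sum_cst_frame.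
by apply: injective_projections; rewrite /= ?addr0.
Qed.

Lemma norm_snd_le {V W : normedModType R} (x : V * W) : `|x.2| <= `|x|.
Proof. by rewrite prod_normE le_max lexx orbT. Qed.

(** Multiplication by the inverse of the frame is bounded and maps lattice
    vectors to integer vectors, so short lattice vectors are mapped to integer
    vectors of norm less than 1. *)
Lemma ML_covering_quot C : C \in unitmx ->
  covering_quot (V := (TR R n : normedModType R)) (ML_quot (cst_frame C)).
Proof.
move=> uC; apply: (lattice_covering_quot (@ML_piE C)).
pose f := mulmxr (invmx C) : 'rV[R]_n -> 'rV[R]_n.
have cf : continuous f.
  move=> x; apply: (@smooth_continuous _ _ _ setT) => //.
  apply: smooth_mulmx; [exact: openT| |exact: smooth_cst].
  by apply: smooth_linear; have [] := @id_clinear R 'rV[R]_n.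
have [c c0 Hc] := linear_lipschitz cf.
exists c^-1; first by rewrite invr_gt0.
move=> k k1; have /int_row_discrete -> : `|int_row k : 'rV[R]_n| < 1.
  have -> : int_row k = f (int_row k *m C) by rewrite /f /= mulmxK.
  apply: le_lt_trans (Hc _) _; rewrite mulrC -ltr_pdivlMr// mul1r.
  exact: le_lt_trans (norm_snd_le (0 : 'rV[R]_n, int_row k *m C)) k1.
by rewrite mul0mx.
Qed.

Lemma ML_good_atlas h C : C \in unitmx -> good_atlas (katlas (ML h (cst_frame C))).
Proof. by move=> uC; apply: quot_good_atlas; exact: ML_covering_quot. Qed.

Lemma PhiX_pi h C (t : 'rV[R]_n) (u : TR R n) :
  PhiX (torus_pi t) (qL h (cst_frame C) u)
  = qL h (cst_frame C) (u.1, u.2 + t *m C).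
Proof.
rewrite /PhiX /qL sum_cst_frameR /torus_repr /torus_pi.
have [k Ek] : exists k,
    repr (\pi_(ML_quot (cst_frame C)) u) = u + (0, int_row k *m C).
  by apply/ML_piE; rewrite reprK.
have [l El] : exists l, repr (\pi_(torus_quot R n) t) = t + int_row l.
  by apply/torus_piE; rewrite reprK.
apply/esym/ML_piE; exists (fun i => k i + l i).
have -> : int_row (fun i => k i + l i) = int_row k + int_row l :> 'rV[R]_n.
  by apply/rowP => i; rewrite !mxE rmorphD.
rewrite Ek El; apply: injective_projections => /=; first by [].
by rewrite !mulmxDl -!addrA; congr (_ + _); rewrite addrCA.
Qed.

End constant_frames.

Section hessian_sum.
Context {R : realType} {n1 n2 : nat}.
Context (psi1 : 'rV[R]_n1 -> R) (psi2 : 'rV[R]_n2 -> R).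
Hypotheses (s1 : smooth setT psi1) (s2 : smooth setT psi2).

Definition sum_potential (p : 'rV[R]_(n1 + n2)) : R :=
  psi1 (lsubmx p) + psi2 (rsubmx p).

Lemma lsubmx_clinear : linear (@lsubmx R 1 n1 n2) /\ continuous (@lsubmx R 1 n1 n2).
Proof. by split; [exact: linearP|exact: continuous_lsubmx]. Qed.

Lemma rsubmx_clinear : linear (@rsubmx R 1 n1 n2) /\ continuous (@rsubmx R 1 n1 n2).
Proof. by split; [exact: linearP|exact: continuous_rsubmx]. Qed.

Lemma smooth_sum_potential : smooth setT sum_potential.
Proof.
have := smooth_add_comp lsubmx_clinear rsubmx_clinear openT openT s1 s2.
by apply: smooth_sub.
Qed.

Lemma mform_hess_sum p v w : mform (hess sum_potential p) v w
  = mform (hess psi1 (lsubmx p)) (lsubmx v) (lsubmx w)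
    + mform (hess psi2 (rsubmx p)) (rsubmx v) (rsubmx w).
Proof.
rewrite (mform_hess smooth_sum_potential) (mform_hess s1) (mform_hess s2).
have -> : (fun y => 'd sum_potential y w)
    = (fun y => 'd psi1 (lsubmx y) (lsubmx w) + 'd psi2 (rsubmx y) (rsubmx w)).
  apply/funext => y.
  exact: (diff_add_comp w lsubmx_clinear rsubmx_clinear
    (smooth_diff s1 (I : setT (lsubmx y))) (smooth_diff s2 (I : setT (rsubmx y)))).
exact: (diff_add_comp v lsubmx_clinear rsubmx_clinear
  (smooth_diff (smooth_d (lsubmx w) s1) (I : setT (lsubmx p)))
  (smooth_diff (smooth_d (rsubmx w) s2) (I : setT (rsubmx p)))).
Qed.

Lemma posdef_hess_sum p : posdef (hess psi1 (lsubmx p)) ->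
  posdef (hess psi2 (rsubmx p)) -> posdef (hess sum_potential p).
Proof.
move=> [_ pos1] [_ pos2]; split.
  have S := smooth_sum_potential.
  by apply/matrixP => i j; rewrite mxE !(hessE S); exact: diff_sym.
have ge1 v : 0 <= mform (hess psi1 (lsubmx p)) v v.
  have [->|/pos1/ltW//] := eqVneq v 0.
  by rewrite /mform !mul0mx mxE.
have ge2 v : 0 <= mform (hess psi2 (rsubmx p)) v v.
  have [->|/pos2/ltW//] := eqVneq v 0.
  by rewrite /mform !mul0mx mxE.
move=> v v0; rewrite mform_hess_sum.
have [l0|l0] := eqVneq (lsubmx v) 0; last first.
  by apply: ltr_wpDr; [exact: ge2|exact: pos1].
apply: ltr_wpDl; first exact: ge1.
apply: pos2; apply: contra_neq v0 => r0.
by rewrite -(hsubmxK v) l0 r0 row_mx0.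
Qed.

Lemma dombrowski_sum u a b : dombrowski_metric (hess sum_potential) u a b
  = dombrowski_metric (hess psi1) (TR_left u) (TR_left a) (TR_left b)
    + dombrowski_metric (hess psi2) (TR_right u) (TR_right a) (TR_right b).
Proof. by rewrite /dombrowski_metric !mform_hess_sum addrACA. Qed.

Section ML_sum.
Context (C1 : 'M[R]_n1) (C2 : 'M[R]_n2).
Hypotheses (uC1 : C1 \in unitmx) (uC2 : C2 \in unitmx).

Definition block_frame : 'M[R]_(n1 + n2) := block_mx C1 0 0 C2.

Lemma block_frame_unit : block_frame \in unitmx.
Proof. by rewrite unitmxE det_ublock unitrM -!unitmxE uC1. Qed.

Lemma int_row_row_mx (k1 : 'I_n1 -> int) (k2 : 'I_n2 -> int) :
  exists k, int_row k = row_mx (int_row k1) (int_row k2) :> 'rV[R]_(n1 + n2).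
Proof.
exists (fun i => match fintype.split i with inl j => k1 j | inr j => k2 j end).
by apply/rowP => i; rewrite !mxE; case: fintype.split => j; rewrite mxE.
Qed.

Lemma int_row_lsubmx (k : 'I_(n1 + n2) -> int) :
  lsubmx (int_row k : 'rV[R]_(n1 + n2)) = int_row (fun i => k (lshift n2 i)).
Proof. by apply/rowP => i; rewrite !mxE. Qed.

Lemma int_row_rsubmx (k : 'I_(n1 + n2) -> int) :
  rsubmx (int_row k : 'rV[R]_(n1 + n2)) = int_row (fun i => k (rshift n1 i)).
Proof. by apply/rowP => i; rewrite !mxE. Qed.

Lemma mul_block_frame (t : 'rV[R]_(n1 + n2)) :
  t *m block_frame = row_mx (lsubmx t *m C1) (rsubmx t *m C2).
Proof.
by rewrite -{1}(hsubmxK t) mul_row_block !mulmx0 addr0 add0r.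
Qed.

Lemma ML_compat (x y : TR R (n1 + n2)) :
  \pi_(ML_quot (cst_frame block_frame)) x = \pi_(ML_quot (cst_frame block_frame)) y
  <-> \pi_(ML_quot (cst_frame C1)) (TR_left x)
      = \pi_(ML_quot (cst_frame C1)) (TR_left y) /\
      \pi_(ML_quot (cst_frame C2)) (TR_right x)
      = \pi_(ML_quot (cst_frame C2)) (TR_right y).
Proof.
split.
  move=> /ML_piE[k ->]; split; apply/ML_piE.
    exists (fun i => k (lshift n2 i)); rewrite mul_block_frame int_row_lsubmx.
    by apply: injective_projections; rewrite /= ?addr0 ?raddfD /= ?row_mxKl.
  exists (fun i => k (rshift n1 i)); rewrite mul_block_frame int_row_rsubmx.
  by apply: injective_projections; rewrite /= ?addr0 ?raddfD /= ?row_mxKr.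
move=> [/ML_piE[k1 E1] /ML_piE[k2 E2]]; apply/ML_piE.
have [k Ek] := int_row_row_mx k1 k2; exists k.
rewrite mul_block_frame Ek row_mxKl row_mxKr.
rewrite -(TR_joinK y) E1 E2; apply: injective_projections => /=.
  by rewrite !addr0 hsubmxK.
by rewrite -add_row_mx hsubmxK.
Qed.

Local Notation M := (ML (hess sum_potential) (cst_frame block_frame)).
Local Notation M1 := (ML (hess psi1) (cst_frame C1)).
Local Notation M2 := (ML (hess psi2) (cst_frame C2)).

Definition ML_left : M -> M1 := quot_proj (Q := ML_quot (cst_frame block_frame))
  (Q' := ML_quot (cst_frame C1)) TR_left.
Definition ML_right : M -> M2 := quot_proj (Q := ML_quot (cst_frame block_frame))
  (Q' := ML_quot (cst_frame C2)) TR_right.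

Lemma ML_left_qL u : ML_left (qL _ _ u) = qL _ _ (TR_left u).
Proof. exact: (quot_proj1 ML_compat). Qed.

Lemma ML_right_qL u : ML_right (qL _ _ u) = qL _ _ (TR_right u).
Proof. exact: (quot_proj2 ML_compat). Qed.

Lemma qL_repr n h (X : 'I_n -> vfield R n) (P : ML h X) :
  qL h X (repr (P : ML_quot X)) = P.
Proof. exact: reprK. Qed.

(** The lattice of the block frame is the product of the two lattices and the
    Hessian metric of the sum is the sum of the two Hessian metrics, so the
    quotient by the product lattice splits as the quotients of the factors. *)
Lemma ML_split : kahler_split ML_left ML_right.
Proof.
have c := ML_covering_quot block_frame_unit.
have c1 := ML_covering_quot uC1; have c2 := ML_covering_quot uC2.
have cl := (@TR_left_clinear R n1 n2).2; have cr := (@TR_right_clinear R n1 n2).2.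
split.
- exact: (quot_proj1_continuous cl ML_compat).
- exact: (quot_proj2_continuous cr ML_compat).
- exact: (quot_proj_nbhs c1 c2 (@TR_join_continuous R n1 n2) (@TR_joinKl R n1 n2)
    (@TR_joinKr R n1 n2) (@TR_joinK R n1 n2) ML_compat).
- move=> s P sP.
  have [t1 [t2 S]] := quot_split_charts c c1 c2 cl cr ML_compat sP.
  exists t1, t2; split=> // a b; have [_ _ E1 E2] := S.
  have E1' : TR_left (section_map s P) = section_map t1 (ML_left P).
    exact: esym (nbhs_singleton E1).
  have E2' : TR_right (section_map s P) = section_map t2 (ML_right P).
    exact: esym (nbhs_singleton E2).
  have := dombrowski_sum (section_map s P) a b.
  by rewrite E1' E2'.
Qed.

End ML_sum.
End hessian_sum.

(** * Products of torus actions and of toric parametrizations *)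

Lemma good_atlas_prod {R : realType} {V V' : normedModType R}
    {T T' : topologicalType} (A : atlas V T) (A' : atlas V' T') :
  good_atlas A -> good_atlas A' -> good_atlas (atlas_prod A A').
Proof.
move=> gA gA' [i j]; have [dom_o dimg k k'] := gA i.
have [dom_o' dimg' m m'] := gA' j.
have imgE : chart_img (A := atlas_prod A A') (i, j) = chart_img i `*` chart_img j.
  apply/seteqP; split => [_ [[P Q] [/= dP dQ] <-]|[x y] [/= [P dP <-] [Q dQ <-]]].
    by split; [exists P|exists Q].
  by exists (P, Q).
split.
- exact: open_setX dom_o dom_o'.
- by rewrite imgE; exact: open_setX.
- move=> [P Q] [/= dP dQ]; have [c1 e1] := k _ dP; have [c2 e2] := m _ dQ.
  split; last by rewrite /= e1 e2.
  exact: (pair_continuous_at (comp_continuous_at (@fst_continuous T T' (P, Q)) c1)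
    (comp_continuous_at (@snd_continuous T T' (P, Q)) c2)).
- rewrite imgE => -[x y] [d1 d2]; have [c1 e1] := k' _ d1; have [c2 e2] := m' _ d2.
  split; last by split.
  exact: (pair_continuous_at (comp_continuous_at (@fst_continuous V V' (x, y)) c1)
    (comp_continuous_at (@snd_continuous V V' (x, y)) c2)).
Qed.

Section torus_product.
Context {R : realType} {n1 n2 : nat}.

Lemma torus_compat (s t : 'rV[R]_(n1 + n2)) :
  \pi_(torus_quot R (n1 + n2)) s = \pi_(torus_quot R (n1 + n2)) t <->
  \pi_(torus_quot R n1) (lsubmx s) = \pi_(torus_quot R n1) (lsubmx t) /\
  \pi_(torus_quot R n2) (rsubmx s) = \pi_(torus_quot R n2) (rsubmx t).
Proof.
split.
  move=> /torus_piE[k ->]; split; apply/torus_piE.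
    by exists (fun i => k (lshift n2 i)); rewrite raddfD /= int_row_lsubmx.
  by exists (fun i => k (rshift n1 i)); rewrite raddfD /= int_row_rsubmx.
move=> [/torus_piE[k1 E1] /torus_piE[k2 E2]]; apply/torus_piE.
have [k Ek] := @int_row_row_mx R n1 n2 k1 k2; exists k.
by rewrite Ek -(hsubmxK t) E1 E2 -add_row_mx hsubmxK.
Qed.

Definition torus_left : torus R (n1 + n2) -> torus R n1 :=
  quot_proj (Q := torus_quot R (n1 + n2)) (Q' := torus_quot R n1) lsubmx.
Definition torus_right : torus R (n1 + n2) -> torus R n2 :=
  quot_proj (Q := torus_quot R (n1 + n2)) (Q' := torus_quot R n2) rsubmx.

Lemma torus_left_pi s : torus_left (torus_pi s) = torus_pi (lsubmx s).
Proof. exact: (quot_proj1 torus_compat). Qed.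

Lemma torus_right_pi s : torus_right (torus_pi s) = torus_pi (rsubmx s).
Proof. exact: (quot_proj2 torus_compat). Qed.

Lemma torus_inj a b :
  torus_left a = torus_left b -> torus_right a = torus_right b -> a = b.
Proof. exact: (quot_proj_inj torus_compat). Qed.

Lemma torus_reprK n (a : torus R n) : torus_pi (torus_repr a) = a.
Proof. exact: reprK. Qed.

Section action.
Context {N1 : kahler_data R n1} {N2 : kahler_data R n2}.
Context {Phi1 : torus R n1 -> N1 -> N1} {Phi2 : torus R n2 -> N2 -> N2}.
Hypotheses (g1 : good_atlas (katlas N1)) (g2 : good_atlas (katlas N2)).
Hypotheses (act1 : is_torus_action Phi1) (act2 : is_torus_action Phi2).
Let Phi := prod_action Phi1 Phi2.

Lemma prod_actionE a P :
  Phi a P = (Phi1 (torus_left a) P.1, Phi2 (torus_right a) P.2).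
Proof. by []. Qed.

(** The product action restricts to the actions of the two subtori on the
    factors. *)
Lemma prod_action_free P :
  free_points Phi P <-> free_points Phi1 P.1 /\ free_points Phi2 P.2.
Proof.
have [id1 _ _] := act1; have [id2 _ _] := act2; case: P => x y /=.
split=> [fr|[fr1 fr2] a].
  split=> a Ea.
    have /fr/(congr1 torus_left) :
        Phi (torus_pi (row_mx (torus_repr a) 0)) (x, y) = (x, y).
      rewrite prod_actionE torus_left_pi torus_right_pi row_mxKl row_mxKr.
      by rewrite torus_reprK /= Ea id2.
    by rewrite !torus_left_pi row_mxKl torus_reprK linear0.
  have /fr/(congr1 torus_right) :
      Phi (torus_pi (row_mx 0 (torus_repr a))) (x, y) = (x, y).
    rewrite prod_actionE torus_left_pi torus_right_pi row_mxKl row_mxKr.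
    by rewrite torus_reprK /= Ea id1.
  by rewrite !torus_right_pi row_mxKr torus_reprK linear0.
rewrite prod_actionE => -[/= /fr1 E1 /fr2 E2]; apply: torus_inj.
  by rewrite E1 torus_left_pi linear0.
by rewrite E2 torus_right_pi linear0.
Qed.

(** Points of both factors are required: on an empty product, no non-trivial
    action is effective. *)
Lemma prod_action_effective (x0 : N1) (y0 : N2) :
  effective Phi1 -> effective Phi2 -> effective Phi.
Proof.
move=> e1 e2 a Ha; apply: torus_inj.
  rewrite torus_left_pi linear0; apply: e1 => x.
  by have := Ha (x, y0); rewrite prod_actionE => -[].
rewrite torus_right_pi linear0; apply: e2 => y.
by have := Ha (x0, y); rewrite prod_actionE => -[].
Qed.

Let TA n := quotient_atlas (torus_quot R n).
Let l1 (x : 'rV[R]_(n1 + n2) * TR R (n1 + n2)) : 'rV[R]_n1 * TR R n1 :=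
  (lsubmx x.1, TR_left x.2).
Let l2 (x : 'rV[R]_(n1 + n2) * TR R (n1 + n2)) : 'rV[R]_n2 * TR R n2 :=
  (rsubmx x.1, TR_right x.2).
Let p1 (x : torus R (n1 + n2) * kahler_prod N1 N2) : torus R n1 * N1 :=
  (torus_left x.1, x.2.1).
Let p2 (x : torus R (n1 + n2) * kahler_prod N1 N2) : torus R n2 * N2 :=
  (torus_right x.1, x.2.2).

Let l1P : linear l1 /\ continuous l1.
Proof.
split; first by move=> c a b; apply: injective_projections;
  [exact: lsubmx_clinear.1|exact: TR_left_clinear.1].
apply: pair_continuous.
  exact: comp_continuous (@fst_continuous _ _) lsubmx_clinear.2.
exact: comp_continuous (@snd_continuous _ _) TR_left_clinear.2.
Qed.

Let l2P : linear l2 /\ continuous l2.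
Proof.
split; first by move=> c a b; apply: injective_projections;
  [exact: rsubmx_clinear.1|exact: TR_right_clinear.1].
apply: pair_continuous.
  exact: comp_continuous (@fst_continuous _ _) rsubmx_clinear.2.
exact: comp_continuous (@snd_continuous _ _) TR_right_clinear.2.
Qed.

Let cp1 : continuous p1.
Proof.
apply: pair_continuous.
  exact: (comp_continuous (@fst_continuous _ _)
    (quot_proj1_continuous lsubmx_clinear.2 torus_compat)).
exact: comp_continuous (@snd_continuous _ _) (@fst_continuous _ _).
Qed.

Let cp2 : continuous p2.
Proof.
apply: pair_continuous.
  exact: (comp_continuous (@fst_continuous _ _)
    (quot_proj2_continuous rsubmx_clinear.2 torus_compat)).
exact: comp_continuous (@snd_continuous _ _) (@snd_continuous _ _).
Qed.

Let TA_good n : good_atlas (TA n).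
Proof. exact: quot_good_atlas torus_covering_quot. Qed.

Let source_split
    (i : chart_index (atlas_prod (TA (n1 + n2)) (katlas (kahler_prod N1 N2))))
    (aP : torus R (n1 + n2) * kahler_prod N1 N2) :
  chart_dom i aP -> exists i1 i2,
    split_charts (A := atlas_prod (TA (n1 + n2)) (katlas (kahler_prod N1 N2)))
      (A1 := atlas_prod (TA n1) (katlas N1))
      (A2 := atlas_prod (TA n2) (katlas N2)) l1 l2 p1 p2 i aP i1 i2.
Proof.
case: i => s [j1 j2]; case: aP => a [P Q] [/= sa [/= dP dQ]].
have [s1 [s2 [d1 d2 E1 E2]]] := quot_split_charts torus_covering_quot
  torus_covering_quot torus_covering_quot lsubmx_clinear.2 rsubmx_clinear.2
  torus_compat sa.
have near_fst (B : set (torus R (n1 + n2))) : nbhs a B ->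
    nbhs ((a, (P, Q)) : torus R (n1 + n2) * kahler_prod N1 N2) (fst @^-1` B).
  move=> nB; exact: (@fst_continuous (torus R (n1 + n2)) (kahler_prod N1 N2)
    (a, (P, Q)) B nB).
exists (s1, j1), (s2, j2); split; [by split|by split| |].
  apply: filterS (near_fst _ E1) => -[b [P' Q']] /= E.
  by apply: injective_projections => /=; [exact: E|rewrite TR_joinKl].
apply: filterS (near_fst _ E2) => -[b [P' Q']] /= E.
by apply: injective_projections => /=; [exact: E|rewrite TR_joinKr].
Qed.

Let Phi_uncurried (x : torus R (n1 + n2) * kahler_prod N1 N2) := Phi x.1 x.2.

Let Phi_continuous : continuous Phi_uncurried.
Proof.
have [_ _ [c1 _]] := act1; have [_ _ [c2 _]] := act2.
have {}c1 : continuous (fun x : torus R n1 * N1 => Phi1 x.1 x.2).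
  by move=> x; exact: c1.
have {}c2 : continuous (fun x : torus R n2 * N2 => Phi2 x.1 x.2).
  by move=> x; exact: c2.
exact: (pair_continuous (comp_continuous cp1 c1) (comp_continuous cp2 c2)).
Qed.

Lemma prod_action_torus_action : is_torus_action Phi.
Proof.
have [id1 add1 sm1] := act1; have [id2 add2 sm2] := act2.
split.
- case=> x y; rewrite prod_actionE torus_left_pi torus_right_pi !linear0.
  by rewrite id1 id2.
- move=> s t [x y]; rewrite !prod_actionE !torus_left_pi !torus_right_pi.
  by rewrite !linearD /= add1 add2.
have [_ _ _ spl] := kahler_prod_split N1 N2.
have gN := kahler_prod_good_atlas g1 g2.
have spl' (i : chart_index (katlas (kahler_prod N1 N2))) (P : kahler_prod N1 N2) :
    chart_dom i P -> exists i1 i2, split_charts (A := katlas (kahler_prod N1 N2))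
      (A1 := katlas N1) (A2 := katlas N2) TR_left TR_right fst snd i P i1 i2.
  by move=> /spl [i1 [i2 [? _]]]; exists i1, i2.
exact: (@smooth_on_split R n1 n2 _ _ _ (torus R (n1 + n2) * kahler_prod N1 N2)%type
  (torus R n1 * N1)%type (torus R n2 * N2)%type (kahler_prod N1 N2) N1 N2
  _ _ _ _ _ _
  (good_atlas_prod (@TA_good (n1 + n2)) gN) (good_atlas_prod (@TA_good n1) g1)
  (good_atlas_prod (@TA_good n2) g2) g1 g2 _ _ l1P l2P p1 p2 fst snd cp1 cp2
  setT setT setT openT openT openT (fun _ _ => I) (fun _ _ => I)
  Phi_uncurried (fun x => Phi1 x.1 x.2) (fun x => Phi2 x.1 x.2)
  (fun _ _ => erefl) (fun _ _ => erefl) (fun x _ => @Phi_continuous x)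
  source_split spl' sm1 sm2).
Qed.

Lemma prod_action_holomorphic a : holomorphic (Phi1 (torus_left a)) ->
  holomorphic (Phi2 (torus_right a)) -> holomorphic (Phi a).
Proof.
have sp := kahler_prod_split N1 N2; have gN := kahler_prod_good_atlas g1 g2.
exact: (split_holomorphic sp sp gN g1 g2 g1 g2 (f := Phi a)).
Qed.

Lemma prod_action_isometric a : holomorphic (Phi1 (torus_left a)) ->
  holomorphic (Phi2 (torus_right a)) -> isometric (Phi1 (torus_left a)) ->
  isometric (Phi2 (torus_right a)) -> isometric (Phi a).
Proof.
have sp := kahler_prod_split N1 N2; have gN := kahler_prod_good_atlas g1 g2.
exact: (split_isometric sp sp gN g1 g2 g1 g2 (f := Phi a)).
Qed.

Section parametrization.
Context (psi1 : 'rV[R]_n1 -> R) (psi2 : 'rV[R]_n2 -> R).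
Hypotheses (s1 : smooth setT psi1) (s2 : smooth setT psi2).

(** [F] is the product of [F1] and [F2] read through the splitting of the
    model space. Its inverse on free points lifts the values of the two
    inverses to tangent vectors and projects their join. *)
Lemma prod_toric_parametrization (L1 : set (TR R n1)) (X1 : 'I_n1 -> vfield R n1)
    (F1 : ML (hess psi1) X1 -> N1) (L2 : set (TR R n2)) (X2 : 'I_n2 -> vfield R n2)
    (F2 : ML (hess psi2) X2 -> N2) :
  toric_parametrization Phi1 L1 F1 -> toric_parametrization Phi2 L2 F2 ->
  exists L X (F : ML (hess (sum_potential psi1 psi2)) X -> kahler_prod N1 N2),
    toric_parametrization Phi L F /\
    forall u, F (qL _ X u) = (F1 (qL _ X1 (TR_left u)), F2 (qL _ X2 (TR_right u))).
Proof.
move=> [gen1 dif1 hol1 iso1 eq1] [gen2 dif2 hol2 iso2 eq2].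
have [C1 uC1 X1E] := generator_cst_frame gen1.
have [C2 uC2 X2E] := generator_cst_frame gen2.
subst X1 X2; set C := block_frame C1 C2.
have uC : C \in unitmx by exact: block_frame_unit.
pose pl := @ML_left R n1 n2 psi1 psi2 C1 C2.
pose pr := @ML_right R n1 n2 psi1 psi2 C1 C2.
pose M := ML (hess (sum_potential psi1 psi2)) (cst_frame C).
have spl := ML_split s1 s2 uC1 uC2.
have sp := kahler_prod_split N1 N2; have gN := kahler_prod_good_atlas g1 g2.
have gM1 := @ML_good_atlas _ _ (hess psi1) _ uC1.
have gM2 := @ML_good_atlas _ _ (hess psi2) _ uC2.
have gM := @ML_good_atlas _ _ (hess (sum_potential psi1 psi2)) _ uC.
pose F (P : M) : kahler_prod N1 N2 := (F1 (pl P), F2 (pr P)).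
have FqL u : F (qL _ _ u) = (F1 (qL _ _ (TR_left u)), F2 (qL _ _ (TR_right u))).
  by rewrite /F /pl /pr ML_left_qL ML_right_qL.
exists (frame_lattice (cst_frame C)), (cst_frame C), F; split => //; split.
- exact: cst_frame_generator.
- have [oU1 FU1 sF1 [G1 [FG1 GF1 sG1]]] := dif1.
  have [oU2 FU2 sF2 [G2 [FG2 GF2 sG2]]] := dif2.
  have UE : free_points Phi = free_points Phi1 `*` free_points Phi2.
    by apply/seteqP; split => P /prod_action_free.
  have oU : open (free_points Phi) by rewrite UE; exact: open_setX.
  split => //.
  + by move=> P; rewrite UE; split; [exact: FU1|exact: FU2].
  + exact: (split_smooth_on spl sp gM gM1 gM2 g1 g2 openT openT openT
      (f := F) (fun _ _ => I) (fun _ _ => I) (fun _ _ => erefl) (fun _ _ => erefl)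
      sF1 sF2).
  pose G (P : kahler_prod N1 N2) : M :=
    qL _ _ (TR_join (repr (G1 P.1 : ML_quot (cst_frame C1)))
                    (repr (G2 P.2 : ML_quot (cst_frame C2)))).
  have Gl P : pl (G P) = G1 P.1 by rewrite /pl ML_left_qL TR_joinKl qL_repr.
  have Gr P : pr (G P) = G2 P.2 by rewrite /pr ML_right_qL TR_joinKr qL_repr.
  exists G; split.
  + move=> P; apply: (quot_proj_inj (@ML_compat _ _ _ C1 C2)).
      by rewrite -[LHS]/(pl _) Gl FG1.
    by rewrite -[LHS]/(pr _) Gr FG2.
  + by move=> [x y]; rewrite UE => -[/= Ux Uy]; rewrite /F Gl Gr /= GF1 ?GF2.
  + apply: (split_smooth_on sp spl gN g1 g2 gM1 gM2 oU oU1 oU2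
      (f := G) _ _ _ _ sG1 sG2) => P.
    * by rewrite UE => -[].
    * by rewrite UE => -[].
    * by move=> _; exact: Gl.
    * by move=> _; exact: Gr.
- exact: (split_holomorphic spl sp gM gM1 gM2 g1 g2 (f := F)).
- exact: (split_isometric spl sp gM gM1 gM2 g1 g2 (f := F)).
- move=> a P; rewrite -[a]torus_reprK -[P]qL_repr; set t := torus_repr a.
  set u := repr _.
  rewrite PhiX_pi !FqL prod_actionE torus_left_pi torus_right_pi /=.
  rewrite -eq1 -eq2 !PhiX_pi mul_block_frame /TR_left /TR_right /=.
  by rewrite !raddfD /= row_mxKl row_mxKr.
Qed.

End parametrization.
End action.
End torus_product.

(** * Regularity of products *)

Section power_series_pullback.
Context {R : realType} {m1 m : nat} (sg : 'I_m1 -> 'I_m).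
Hypothesis sg_inj : injective sg.

Definition coord_proj (x : 'rV[R]_m) : 'rV[R]_m1 := \row_j x 0 (sg j).

Lemma coord_proj_continuous : continuous coord_proj.
Proof.
move=> x; apply: (@smooth_continuous _ _ _ setT) => //.
apply: smooth_mx => [|i j]; first exact: openT.
under eq_fun do rewrite mxE.
apply: smooth_coord; first exact: openT.
by apply: smooth_linear; have [] := @id_clinear R 'rV[R]_m.
Qed.

Lemma big_coord (T : Type) (idx : T) (op : Monoid.com_law idx) (F : 'I_m -> T) :
  (forall i, i \notin codom sg -> F i = idx) ->
  \big[op/idx]_i F i = \big[op/idx]_j F (sg j).
Proof.
move=> F0; rewrite (bigID (mem (codom sg)))/= [X in op _ X]big1// Monoid.mulm1.
rewrite (reindex_omap sg (fun i => [pick j | sg j == i])); last first.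
  move=> i /codomP[j ->]; case: pickP => [j' /eqP E|/(_ j)].
    by rewrite /= E.
  by rewrite eqxx.
apply: eq_bigl => j; rewrite codom_f /=.
by case: pickP => [j' /eqP/sg_inj ->|/(_ j)]; rewrite eqxx.
Qed.

Definition supp_in (al : 'I_m -> nat) : bool :=
  [forall i, (i \notin codom sg) ==> (al i == 0)%N].

(** The coefficients of a power series in the coordinates selected by [sg], as
    a power series in all the coordinates. *)
Definition pull_coeff (a : ('I_m1 -> nat) -> R) (al : 'I_m -> nat) : R :=
  if supp_in al then a (fun j => al (sg j)) else 0.

(** The multi-indices that vanish outside the image of [sg] correspond to the
    multi-indices on the selected coordinates. *)
Lemma homog_part_pull (a : ('I_m1 -> nat) -> R) (y : 'rV[R]_m) k :
  homog_part (pull_coeff a) y k = homog_part a (coord_proj y) k.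
Proof.
rewrite /homog_part.
(* Extension by zero and restriction of multi-indices. *)
pose ext (be : {ffun 'I_m1 -> 'I_k.+1}) : {ffun 'I_m -> 'I_k.+1} :=
  [ffun i => if [pick j | sg j == i] is Some j then be j else ord0].
pose res (al : {ffun 'I_m -> 'I_k.+1}) : {ffun 'I_m1 -> 'I_k.+1} :=
  [ffun j => al (sg j)].
have ext_sg be j : ext be (sg j) = be j.
  rewrite ffunE; case: pickP => [j' /eqP/sg_inj -> //|/(_ j)].
  by rewrite eqxx.
have ext_out be i : i \notin codom sg -> ext be i = ord0.
  rewrite ffunE => ni; case: pickP => // j /eqP ji.
  by rewrite -ji codom_f in ni.
have supp_ext be : supp_in (fun i => ext be i).
  by apply/forallP => i; apply/implyP => ni; rewrite ext_out.
rewrite (bigID (fun al : {ffun 'I_m -> 'I_k.+1} => supp_in (fun i => al i))) /=.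
rewrite [X in _ + X]big1 ?addr0; last first.
  by move=> al /andP[_ /negbTE nal]; rewrite /pull_coeff nal mul0r.
rewrite (reindex_onto ext res); last first.
  move=> al /andP[_ /forallP sal]; apply/ffunP => i.
  have [/codomP[j ->]|ni] := boolP (i \in codom sg).
    by rewrite ext_sg ffunE.
  rewrite ext_out//; apply/val_inj => /=.
  by have := sal i; rewrite ni => /eqP.
apply: eq_big => [be|be _].
  rewrite supp_ext andbT (_ : res (ext be) == be); last first.
    by apply/eqP/ffunP => j; rewrite ffunE ext_sg.
  rewrite andbT (big_coord addn (F := fun i => ext be i : nat)).
    by under eq_bigr do rewrite ext_sg.
  by move=> i ni; rewrite ext_out.
rewrite /pull_coeff supp_ext; congr (a _ * _).
  by apply/funext => j; rewrite ext_sg.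
rewrite (big_coord *%R (F := fun i => y 0 i ^+ ext be i)).
  by apply: eq_bigr => j _; rewrite ext_sg mxE.
by move=> i ni; rewrite ext_out.
Qed.

Lemma analytic_pull U (f : 'rV[R]_m1 -> R) : analytic U f ->
  analytic (coord_proj @^-1` U) (fun x => f (coord_proj x)).
Proof.
move=> anf x0 Ux0; have [a Ha] := anf _ Ux0.
exists (pull_coeff a).
have projB x : coord_proj (x - x0) = coord_proj x - coord_proj x0.
  by apply/rowP => j; rewrite !mxE.
have absE : (fun al => `|pull_coeff a al|) = pull_coeff (fun al => `|a al|).
  by apply/funext => al; rewrite /pull_coeff; case: ifP; rewrite ?normr0.
pose P z := cvgn (series (homog_part (fun al => `|a al|)
    (\row_i `|(z - coord_proj x0) 0 i|))) /\
  series (homog_part a (z - coord_proj x0)) @ \oo --> f z.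
have Hb : \forall x \near x0, P (coord_proj x).
  exact: (@coord_proj_continuous x0 P Ha).
apply: filterS Hb => x [cvx limx].
split.
  rewrite absE (_ : homog_part _ _ = homog_part (fun al => `|a al|)
    (\row_i `|(coord_proj x - coord_proj x0) 0 i|))//.
  apply/funext => k; rewrite homog_part_pull; congr homog_part.
  by apply/rowP => j; rewrite !mxE.
rewrite (_ : homog_part _ _ = homog_part a (coord_proj x - coord_proj x0))//.
by apply/funext => k; rewrite homog_part_pull projB.
Qed.

End power_series_pullback.

Section analytic_sum.
Context {R : realType} {m : nat}.

Lemma homog_partD (a b : ('I_m -> nat) -> R) (y : 'rV[R]_m) :
  homog_part (fun al => a al + b al) y = homog_part a y + homog_part b y.
Proof.
apply/funext => k; rewrite /homog_part fctE -big_split.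
by apply: eq_bigr => al _; rewrite mulrDl.
Qed.

Lemma homog_part_le (a b : ('I_m -> nat) -> R) (y : 'rV[R]_m) k :
  (forall i, 0 <= y 0 i) -> (forall al, a al <= b al) ->
  homog_part a y k <= homog_part b y k.
Proof.
move=> y0 ab; apply: ler_sum => al _; apply: ler_wpM2r => //.
by apply: prodr_ge0 => i _; exact: exprn_ge0.
Qed.

Lemma homog_part_ge0 (a : ('I_m -> nat) -> R) (y : 'rV[R]_m) k :
  (forall i, 0 <= y 0 i) -> (forall al, 0 <= a al) -> 0 <= homog_part a y k.
Proof.
move=> y0 a0; apply: sumr_ge0 => al _; apply: mulr_ge0 => //.
by apply: prodr_ge0 => i _; exact: exprn_ge0.
Qed.

Lemma analyticD U (f g : 'rV[R]_m -> R) : analytic U f -> analytic U g ->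
  analytic U (fun x => f x + g x).
Proof.
move=> anf ang x0 Ux0; have [a Ha] := anf _ Ux0; have [b Hb] := ang _ Ux0.
exists (fun al => a al + b al); apply: filterS2 Ha Hb => x [ca la] [cb lb].
split; last by rewrite homog_partD seriesD; exact: cvgD.
have y0 i : 0 <= (\row_j `|(x - x0) 0 j|) 0 i by rewrite mxE.
apply: (@series_le_cvg _ _ (homog_part (fun al => `|a al| + `|b al|)
  (\row_j `|(x - x0) 0 j|))) => [k|k|k|].
- exact: homog_part_ge0.
- by apply: homog_part_ge0 => // al; rewrite addr_ge0.
- by apply: homog_part_le => // al; exact: ler_normD.
- by rewrite homog_partD; exact: is_cvg_seriesD.
Qed.

Lemma analytic_sub U U' (f : 'rV[R]_m -> R) :
  U' `<=` U -> analytic U f -> analytic U' f.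
Proof. by move=> UU' anf x0 /UU'; exact: anf. Qed.

End analytic_sum.

Section simply_connected_product.
Context {R : realType} {T1 T2 : topologicalType}.

Lemma simply_connected_prod : simply_connected R T1 -> simply_connected R T2 ->
  simply_connected R (T1 * T2)%type.
Proof.
move=> [pc1 sc1] [pc2 sc2]; split.
  move=> [x1 x2] [y1 y2].
  have [c1 [cc1 c10 c11]] := pc1 x1 y1; have [c2 [cc2 c20 c21]] := pc2 x2 y2.
  exists (fun t => (c1 t, c2 t)); split; last 2 first.
  - by rewrite c10 c20.
  - by rewrite c11 c21.
  exact: (pair_continuous cc1 cc2).
move=> c cc c01.
have cc1 := comp_continuous cc (@fst_continuous T1 T2).
have cc2 := comp_continuous cc (@snd_continuous T1 T2).
have [H1 [cH1 H10 H11 H1t]] := sc1 _ cc1 (congr1 fst c01).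
have [H2 [cH2 H20 H21 H2t]] := sc2 _ cc2 (congr1 snd c01).
exists (fun st => (H1 st, H2 st)); split.
- exact: (pair_continuous cH1 cH2).
- by move=> s s01; rewrite H10// H20// -surjective_pairing.
- by move=> s s01; rewrite H11// H21// -surjective_pairing.
- move=> t t01; have [-> ->] := H1t t t01; have [-> ->] := H2t t t01.
  by rewrite -surjective_pairing.
Qed.

End simply_connected_product.

Section joined_curves.
Context {R : realType} {n1 n2 : nat} (x1 : R -> TR R n1) (x2 : R -> TR R n2).

Lemma derive1_join (t : R) : derivable x1 t 1 -> derivable x2 t 1 ->
  derivable (fun s => TR_join (x1 s) (x2 s)) t 1 /\
  derive1 (fun s => TR_join (x1 s) (x2 s)) t
    = TR_join (derive1 x1 t) (derive1 x2 t).
Proof.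
move=> /derivable1_diffP d1 /derivable1_diffP d2.
have lid := @id_clinear R R.
have [d E] := diff_join lid lid d1 d2.
split; first exact/derivable1_diffP.
apply: (etrans (derive1E' d)); apply: (etrans (E 1)).
by rewrite (derive1E' d1) (derive1E' d2).
Qed.

Lemma derive1_join_near (t : R) :
  (\forall s \near t, derivable x1 s 1) -> (\forall s \near t, derivable x2 s 1) ->
  {near t, (fun s => TR_join (derive1 x1 s) (derive1 x2 s))
    =1 derive1 (fun s => TR_join (x1 s) (x2 s))}.
Proof.
by apply: filterS2 => s d1 d2; have [_ ->] := derive1_join d1 d2.
Qed.

End joined_curves.

Section complete_product.
Context {R : realType} {n1 n2 : nat}.
Context (N1 : kahler_data R n1) (N2 : kahler_data R n2).
Hypotheses (k1 : is_kahler N1) (k2 : is_kahler N2).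

(** The metric of the product is a sum of two terms, each depending on the
    coordinates of one factor, so the geodesic equation is the sum of the
    equations of the factors. *)
Lemma geodesic_prod (c1 : R -> N1) (c2 : R -> N2) : geodesic c1 -> geodesic c2 ->
  geodesic (N := kahler_prod N1 N2) (fun t => (c1 t, c2 t)).
Proof.
move=> [cc1 G1] [cc2 G2]; split; first exact: (pair_continuous cc1 cc2).
move=> t [i1 i2] [/= t1 t2].
have [d1 dd1 E1] := G1 t i1 t1; have [d2 dd2 E2] := G2 t i2 t2.
set x1 := chart i1 \o c1 in d1 dd1 E1; set x2 := chart i2 \o c2 in d2 dd2 E2.
set x := (fun s => TR_join (x1 s) (x2 s)).
rewrite -[_ \o _]/x.
have near_d := derive1_join_near d1 d2.
have dx : derive1 x t = TR_join (derive1 x1 t) (derive1 x2 t).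
  by have [] := derive1_join (nbhs_singleton d1) (nbhs_singleton d2).
have [dj ddj] := derive1_join dd1 dd2.
have ddx : derive1 (derive1 x) t
    = TR_join (derive1 (derive1 x1) t) (derive1 (derive1 x2) t).
  by rewrite -ddj !derive1E; apply/esym/near_eq_derive.
split.
- by apply: filterS2 d1 d2 => s e1 e2; have [] := derive1_join e1 e2.
- exact: (near_eq_derivable near_d dj).
move=> w; rewrite dx ddx.
have [_ _ _ _ /(_ i1) [S1 _]] := k1; have [_ _ _ _ /(_ i2) [S2 _]] := k2.
have I1 : chart_img i1 (x1 t) by exists (c1 t).
have I2 : chart_img i2 (x2 t) by exists (c2 t).
have D (u v v' : TR R (n1 + n2)) :
  'd (fun y => kmetric (k := kahler_prod N1 N2) (i1, i2)
       (chart_inv (a := katlas (kahler_prod N1 N2)) (i1, i2) y) v v') (x t) u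
  = 'd (fun y => kmetric i1 (chart_inv i1 y) (TR_left v) (TR_left v'))
      (x1 t) (TR_left u)
  + 'd (fun y => kmetric i2 (chart_inv i2 y) (TR_right v) (TR_right v'))
      (x2 t) (TR_right u).
  have e1 := smooth_diff (S1 (TR_left v) (TR_left v')) I1.
  have e2 := smooth_diff (S2 (TR_right v) (TR_right v')) I2.
  have := diff_add_comp (x := x t) u TR_left_clinear TR_right_clinear.
  by rewrite TR_joinKl TR_joinKr => /(_ _ _ _ e1 e2).
pose v1 := derive1 x1 t; pose v2 := derive1 x2 t.
have D1 := D (TR_join v1 v2) (TR_join v1 v2) w.
have D2 := D w (TR_join v1 v2) (TR_join v1 v2).
rewrite !TR_joinKl !TR_joinKr in D1 D2.
have M : kmetric (k := kahler_prod N1 N2) (i1, i2)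
    (chart_inv (a := katlas (kahler_prod N1 N2)) (i1, i2) (x t))
    (TR_join (derive1 (derive1 x1) t) (derive1 (derive1 x2) t)) w
  = kmetric i1 (chart_inv i1 (x1 t)) (derive1 (derive1 x1) t) (TR_left w)
  + kmetric i2 (chart_inv i2 (x2 t)) (derive1 (derive1 x2) t) (TR_right w).
  by rewrite /= !TR_joinKl !TR_joinKr.
apply: (etrans (congr2 +%R (congr2 +%R M D1)
  (congr1 (fun z => - (2^-1 * z)) D2))).
have alg (a1 a2 b1 b2 e1 e2 : R) : a1 + b1 - 2^-1 * e1 = 0 ->
    a2 + b2 - 2^-1 * e2 = 0 ->
    (a1 + a2) + (b1 + b2) - 2^-1 * (e1 + e2) = 0 by lra.
by apply: alg; [exact: E1|exact: E2].
Qed.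

Lemma complete_prod : complete_kahler N1 -> complete_kahler N2 ->
  complete_kahler (kahler_prod N1 N2).
Proof.
move=> co1 co2 [P Q] [i1 i2] v [/= dP dQ].
have [c1 [g1 c10 v1]] := co1 P i1 (TR_left v) dP.
have [c2 [g2 c20 v2]] := co2 Q i2 (TR_right v) dQ.
exists (fun t => (c1 t, c2 t)); split.
- exact: geodesic_prod.
- by rewrite c10 c20.
have [_ /(_ 0 i1)] := g1; rewrite c10 => /(_ dP)[/nbhs_singleton d1 _ _].
have [_ /(_ 0 i2)] := g2; rewrite c20 => /(_ dQ)[/nbhs_singleton d2 _ _].
have [_ E] := derive1_join d1 d2.
by apply: (etrans E); rewrite v1 v2 TR_joinK.
Qed.

(** A point of the model space of the product is the row of coordinates (x1,
    x2, y1, y2), from which this selects (x1, y1); [inr_coord] selects (x2,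
    y2). *)
Definition inl_coord (i : 'I_(n1 + n1)) : 'I_((n1 + n2) + (n1 + n2)) :=
  match fintype.split i with
  | inl j => lshift _ (lshift n2 j)
  | inr j => rshift _ (lshift n2 j)
  end.

Definition inr_coord (i : 'I_(n2 + n2)) : 'I_((n1 + n2) + (n1 + n2)) :=
  match fintype.split i with
  | inl j => lshift _ (rshift n1 j)
  | inr j => rshift _ (rshift n1 j)
  end.

Lemma inl_coord_inj : injective inl_coord.
Proof.
move=> i j; rewrite /inl_coord.
case: (split_ordP i) => i' ->; case: (split_ordP j) => j' -> /eqP.
all: by rewrite ?eq_shift// => /eqP ->.
Qed.

Lemma inr_coord_inj : injective inr_coord.
Proof.
move=> i j; rewrite /inr_coord.
case: (split_ordP i) => i' ->; case: (split_ordP j) => j' -> /eqP.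
all: by rewrite ?eq_shift// => /eqP ->.
Qed.

Lemma inl_coordP (x : 'rV[R]_((n1 + n2) + (n1 + n2))) :
  (lsubmx (coord_proj inl_coord x), rsubmx (coord_proj inl_coord x))
  = TR_left (lsubmx x, rsubmx x).
Proof.
apply: injective_projections; apply/rowP => j; rewrite !mxE /inl_coord.
  by rewrite (unsplitK (inl j)).
by rewrite (unsplitK (inr j)).
Qed.

Lemma inr_coordP (x : 'rV[R]_((n1 + n2) + (n1 + n2))) :
  (lsubmx (coord_proj inr_coord x), rsubmx (coord_proj inr_coord x))
  = TR_right (lsubmx x, rsubmx x).
Proof.
apply: injective_projections; apply/rowP => j; rewrite !mxE /inr_coord.
  by rewrite (unsplitK (inl j)).
by rewrite (unsplitK (inr j)).
Qed.

Lemma analytic_metric_prod : analytic_metric N1 -> analytic_metric N2 ->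
  analytic_metric (kahler_prod N1 N2).
Proof.
move=> a1 a2 [i1 i2] a b.
have A1 := analytic_pull inl_coord_inj (a1 i1 (TR_left a) (TR_left b)).
have A2 := analytic_pull inr_coord_inj (a2 i2 (TR_right a) (TR_right b)).
have imgS : [set x : 'rV[R]_((n1 + n2) + (n1 + n2)) |
    chart_img (A := katlas (kahler_prod N1 N2)) (i1, i2) (lsubmx x, rsubmx x)]
  `<=` coord_proj inl_coord @^-1` [set x | chart_img i1 (lsubmx x, rsubmx x)]
   `&` coord_proj inr_coord @^-1` [set x | chart_img i2 (lsubmx x, rsubmx x)].
  move=> x [[P Q] [/= dP dQ] E]; split; rewrite /= ?inl_coordP ?inr_coordP -E.
    by rewrite TR_joinKl; exists P.
  by rewrite TR_joinKr; exists Q.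
have := analyticD (analytic_sub (subset_trans imgS (@subIsetl _ _ _)) A1)
                  (analytic_sub (subset_trans imgS (@subIsetr _ _ _)) A2).
rewrite (_ : (fun x => _ + _) = (fun x => kmetric (k := kahler_prod N1 N2)
  (i1, i2) (chart_inv (a := katlas (kahler_prod N1 N2)) (i1, i2)
    (lsubmx x, rsubmx x)) a b))//.
by apply/funext => x; rewrite inl_coordP inr_coordP.
Qed.

Lemma regular_prod : regular N1 -> regular N2 -> regular (kahler_prod N1 N2).
Proof.
move=> [co1 sc1 cp1 an1] [co2 sc2 cp2 an2]; split.
- exact: connected_setT_prod.
- exact: simply_connected_prod.
- exact: complete_prod.
- exact: analytic_metric_prod.
Qed.

End complete_product.

(** * The product of two torifications *)

Theorem proposition11p5 (R : realType) (n1 n2 : nat)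
    (psi1 : 'rV[R]_n1 -> R) (psi2 : 'rV[R]_n2 -> R)
    (smooth_psi1 : smooth setT psi1) (smooth_psi2 : smooth setT psi2)
    (posdef_psi1 : forall p, posdef (hess psi1 p))
    (posdef_psi2 : forall p, posdef (hess psi2 p))
    (N1 : kahler_data R n1) (N2 : kahler_data R n2)
    (Phi1 : torus R n1 -> N1 -> N1) (Phi2 : torus R n2 -> N2 -> N2)
    (tor1 : torification (hess psi1) Phi1)
    (tor2 : torification (hess psi2) Phi2) :
  let psi := fun p : 'rV[R]_(n1 + n2) => psi1 (lsubmx p) + psi2 (rsubmx p) in
  let Phi := prod_action Phi1 Phi2 in
  [/\ torification (hess psi) Phi,
      forall (tau1 : 'rV[R]_n1 * 'rV[R]_n1 -> N1)
             (tau2 : 'rV[R]_n2 * 'rV[R]_n2 -> N2),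
        compatible_covering (hess psi1) Phi1 tau1 ->
        compatible_covering (hess psi2) Phi2 tau2 ->
        compatible_covering (hess psi) Phi
          (fun u => (tau1 (TR_left u), tau2 (TR_right u))) &
      regular N1 -> regular N2 -> regular (kahler_prod N1 N2)].
Proof.
move=> psi Phi.
have [_ [kN1 con1] [act1 eff1] mor1 [L1 [X1 [F1 par1]]]] := tor1.
have [_ [kN2 con2] [act2 eff2] mor2 [L2 [X2 [F2 par2]]]] := tor2.
have g1 : good_atlas (katlas N1) by apply: manifold_good_atlas; case: kN1.
have g2 : good_atlas (katlas N2) by apply: manifold_good_atlas; case: kN2.
have param := @prod_toric_parametrization R n1 n2 N1 N2 Phi1 Phi2 g1 g2 act1 act2
  psi1 psi2 smooth_psi1 smooth_psi2.
split.
- split.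
  + apply: hess_dually_flat; first exact: smooth_sum_potential.
    by move=> p; exact: posdef_hess_sum.
  + split; first exact: kahler_prod_kahler.
    exact: connected_setT_prod.
  + split; first exact: prod_action_torus_action.
    (* The torification maps provide base points, without which the product
       could be empty and its action not effective. *)
    exact: (prod_action_effective (F1 (qL _ X1 0)) (F2 (qL _ X2 0))).
  + move=> a; have [h1 i1] := mor1 (torus_left a).
    have [h2 i2] := mor2 (torus_right a).
    by split; [exact: prod_action_holomorphic|exact: prod_action_isometric].
  + by have [L [X [F [par _]]]] := param _ _ _ _ _ _ par1 par2; exists L, X, F.
- move=> tau1 tau2 [L1' [X1' [F1' [par1' tau1E]]]] [L2' [X2' [F2' [par2' tau2E]]]].
  have [L [X [F [par FE]]]] := param _ _ _ _ _ _ par1' par2'.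
  by exists L, X, F; split => // u; rewrite FE tau1E tau2E.
- exact: regular_prod.
Qed.
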